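(* Let $k_+,k_-\in\mathbb K(q)$ be nonzero and $\bar\rho=k_+k_-(q+q^{-1})^2$. Put $U=qu^2/(q+q^{-1})$ and $$\mathcal W_+(u)=\sum_{k\ge 0}\mathsf W_{-k}U^{-k-1},\quad \mathcal W_-(u)=\sum_{k\ge 0}\mathsf W_{k+1}U^{-k-1},\quad \mathcal G_+(u)=\sum_{k\ge 0}\mathsf G_{k+1}U^{-k-1},\quad \mathcal G_-(u)=\sum_{k\ge 0}\tilde{\mathsf G}_{k+1}U^{-k-1},$$ $$K(u)=\begin{pmatrix} uq\,\mathcal W_+(u) & \frac{1}{k_-(q+q^{-1})}\mathcal G_+(u)+\frac{k_+(q+q^{-1})}{q-q^{-1}}\\[2pt] \frac{1}{k_+(q+q^{-1})}\mathcal G_-(u)+\frac{k_-(q+q^{-1})}{q-q^{-1}} & uq\,\mathcal W_-(u)\end{pmatrix}.$$ Then the algebra $\bar{\mathcal A}_q$ has the following (Freidel–Maillet type) presentation: it is the unital associative $\mathbb K(q)$-algebra generated by $\{\mathsf W_{-k},\mathsf W_{k+1},\mathsf G_{k+1},\tilde{\mathsf G}_{k+1}\mid k\in\mathbb N\}$ with defining relations given by the coefficients (in the indeterminates $u,v$) of the matrix equation $$R(u/v)\,(K(u)\otimes \mathbb I)\,R^{(0)}\,(\mathbb I\otimes K(v))=(\mathbb I\otimes K(v))\,R^{(0)}\,(K(u)\otimes\mathbb I)\,R(u/v).$$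
   Context: $\mathbb N=\{0,1,2,\dots\}$; $\mathbb K$ is an algebraically closed field of characteristic $0$; $\mathbb K(q)$ is the field of rational functions in $q$; $[X,Y]=XY-YX$ and $[X,Y]_q=qXY-q^{-1}YX$. $\bar{\mathcal A}_q$ (depending on $\bar\rho\in\mathbb K(q)$) is the unital associative $\mathbb K(q)$-algebra with generators $\mathsf W_{-k},\mathsf W_{k+1},\mathsf G_{k+1},\tilde{\mathsf G}_{k+1}$ ($k\in\mathbb N$) and relations, for all $k,\ell\in\mathbb N$: $[\mathsf W_0,\mathsf W_{k+1}]=[\mathsf W_{-k},\mathsf W_1]=(\tilde{\mathsf G}_{k+1}-\mathsf G_{k+1})/(q+q^{-1})$; $[\mathsf W_0,\mathsf G_{k+1}]_q=[\tilde{\mathsf G}_{k+1},\mathsf W_0]_q=\bar\rho\,\mathsf W_{-k-1}$; $[\mathsf G_{k+1},\mathsf W_1]_q=[\mathsf W_1,\tilde{\mathsf G}_{k+1}]_q=\bar\rho\,\mathsf W_{k+2}$; $[\mathsf W_{-k},\mathsf W_{-\ell}]=0$; $[\mathsf W_{k+1},\mathsf W_{\ell+1}]=0$; $[\mathsf W_{-k},\mathsf W_{\ell+1}]+[\mathsf W_{k+1},\mathsf W_{-\ell}]=0$; $[\mathsf W_{-k},\mathsf G_{\ell+1}]+[\mathsf G_{k+1},\mathsf W_{-\ell}]=0$; $[\mathsf W_{-k},\tilde{\mathsf G}_{\ell+1}]+[\tilde{\mathsf G}_{k+1},\mathsf W_{-\ell}]=0$; $[\mathsf W_{k+1},\mathsf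 G_{\ell+1}]+[\mathsf G_{k+1},\mathsf W_{\ell+1}]=0$; $[\mathsf W_{k+1},\tilde{\mathsf G}_{\ell+1}]+[\tilde{\mathsf G}_{k+1},\mathsf W_{\ell+1}]=0$; $[\mathsf G_{k+1},\mathsf G_{\ell+1}]=0$; $[\tilde{\mathsf G}_{k+1},\tilde{\mathsf G}_{\ell+1}]=0$; $[\tilde{\mathsf G}_{k+1},\mathsf G_{\ell+1}]+[\mathsf G_{k+1},\tilde{\mathsf G}_{\ell+1}]=0$. In the ordered basis $e_1\otimes e_1,e_1\otimes e_2,e_2\otimes e_1,e_2\otimes e_2$: $$R(u)=\begin{pmatrix} uq-u^{-1}q^{-1}&0&0&0\\0&u-u^{-1}&q-q^{-1}&0\\0&q-q^{-1}&u-u^{-1}&0\\0&0&0&uq-u^{-1}q^{-1}\end{pmatrix},\qquad R^{(0)}=\mathrm{diag}(1,q^{-1},q^{-1},1).$$ $\mathbb I$ is the $2\times 2$ identity matrix. *)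

(* Defs.v *)
From HB Require Import structures.
From mathcomp Require Import all_boot all_order all_algebra.
From mathcomp Require Import generic_quotient ring_quotient.
From mathcomp Require Import mxtens.
From mathcomp Require Import boolp classical_sets fsbigop functions cardinality.
From mathcomp Require Import finmap.
From mathcomp.multinomials Require Import monalg.
From mathcomp Require Import zify.

Set Implicit Arguments.
Unset Strict Implicit.
Unset Printing Implicit Defensive.

Import Order.TTheory GRing.Theory Num.Theory.

Local Open Scope ring_scope.
Local Open Scope quotient_scope.

(* [laurent A]: formal series \sum_n a_n z^n with a_n = 0 for n large, i.e. the
   ring A((z^-1)) of Laurent series in z^-1 over a noncommutative ring A; the
   indeterminate z is central. *)
Section LaurentDef.
Variable A : zmodType.

Definition bounded_above (f : int -> A) :=
  exists a : int, forall n : int, a < n -> f n = 0.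

Definition bounded_above_pred : {pred int -> A} := fun f => `[< bounded_above f >].

Fact bounded_above_zmod_closed : zmod_closed bounded_above_pred.
Proof.
split=> [|f g /asboolP[a fa] /asboolP[b gb]]; apply/asboolP.
  by exists 0.
exists (Num.max a b) => n; rewrite gt_max => /andP[an bn].
by rewrite -[LHS]/(f n - g n) fa ?gb ?subr0.
Qed.

HB.instance Definition _ :=
  GRing.isZmodClosed.Build (int -> A) bounded_above_pred bounded_above_zmod_closed.

Record laurent := Laurent {
  lcoef :> int -> A;
  _ : bounded_above_pred lcoef }.

HB.instance Definition _ := [isSub for lcoef].
HB.instance Definition _ := [Choice of laurent by <:].
HB.instance Definition _ := [SubChoice_isSubZmodule of laurent by <:].

Lemma laurentP (f g : laurent) : (forall n, f n = g n) -> f = g.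
Proof. by move=> fg; apply/val_inj/funext. Qed.

Lemma lcoefD (f g : laurent) n : (f + g) n = f n + g n. Proof. by []. Qed.

Lemma laurent_bounded (f : laurent) : bounded_above f.
Proof. by case: f => f /= /asboolP. Qed.

End LaurentDef.

Section LaurentRing.
Variable A : nzRingType.
Implicit Types (f g h : laurent A).

(* Cauchy product; for each n only finitely many terms are nonzero. *)
Definition lmul_fun f g : int -> A :=
  fun n => \sum_(i \in [set: int]%classic) f i * g (n - i).

Let below (a : int) f := forall n : int, a < n -> f n = 0.

Let P (a : int) (N : nat) f := \poly_(k < N) f (a - k%:Z).

Let below_ub f : exists a, below a f. Proof. exact: laurent_bounded. Qed.

Let lmul_funE a b f g (m : nat) : below a f -> below b g ->
  lmul_fun f g (a + b - m%:Z) = (P a m.+1 f * P b m.+1 g)`_m.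
Proof.
move=> fa gb; rewrite coefM /lmul_fun.
rewrite (fsbigE [seq a - k%:Z | k <- iota 0 m.+1]).
- rewrite big_map -[iota _ _]/(index_iota 0 m.+1) big_mkord.
  apply: eq_big => [i|[i im] _ /=]; first by rewrite in_setT.
  rewrite !coef_poly im ltnS leq_subr; congr (_ * g _).
  by lia.
- by rewrite map_inj_uniq ?iota_uniq// => i j; lia.
- by [].
- move=> i _; apply: contraNeq => fg; have ia : i <= a.
    by rewrite leNgt; apply/negP => /fa f0; move: fg; rewrite f0 mul0r eqxx.
  have ib : a + b - m%:Z - i <= b.
    by rewrite leNgt; apply/negP => /gb g0; move: fg; rewrite g0 mulr0 eqxx.
  by apply/mapP; exists (absz (a - i)%R); [rewrite mem_iota; lia|lia].
Qed.

Let lmul_fun_gt a b f g : below a f -> below b g ->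
  forall n : int, a + b < n -> lmul_fun f g n = 0.
Proof.
move=> fa gb n abn; rewrite /lmul_fun fsbig1// => i _.
have [ia|ai] := leP i a; last by rewrite fa ?mul0r.
by rewrite gb ?mulr0//; lia.
Qed.

Fact lmul_bounded f g : bounded_above_pred (lmul_fun f g).
Proof.
have [[a fa] [b gb]] := (below_ub f, below_ub g).
by apply/asboolP; exists (a + b); apply: lmul_fun_gt.
Qed.

Definition lmul f g := Laurent (lmul_bounded f g).

(* [lmono n x] is the monomial x z^n. *)
Fact lmono_bounded (n : int) (x : A) :
  bounded_above_pred (fun i : int => if i == n then x else 0).
Proof. by apply/asboolP; exists n => i; case: eqP => // ->; rewrite ltxx. Qed.

Definition lmono n x := Laurent (lmono_bounded n x).

Let below_lmul a b f g : below a f -> below b g -> below (a + b) (lmul f g).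
Proof. exact: lmul_fun_gt. Qed.

Let coefP a N f k : (P a N f)`_k = if (k < N)%N then f (a - k%:Z) else 0.
Proof. exact: coef_poly. Qed.

Let coef_mulP a b m k f g : (k <= m)%N ->
  (P a k.+1 f * P b k.+1 g)`_k = (P a m.+1 f * P b m.+1 g)`_k.
Proof.
move=> km; rewrite !coefM; apply: eq_bigr => -[i /= ik] _.
by rewrite !coefP !ltnS; congr (_ * _); repeat case: ifP => //; lia.
Qed.

Let P_lmul a b m f g k : below a f -> below b g -> (k <= m)%N ->
  (P (a + b) m.+1 (lmul f g))`_k = (P a m.+1 f * P b m.+1 g)`_k.
Proof.
by move=> fa gb km; rewrite coefP ltnS km/= lmul_funE// (coef_mulP _ _ _ _ km).
Qed.

Let lmulA : associative lmul.
Proof.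
move=> f g h; apply: laurentP => n.
have [[a fa] [b gb] [c hc]] := And3 (below_ub f) (below_ub g) (below_ub h).
have [abn|nab] := ltP (a + b + c) n.
  rewrite (below_lmul (below_lmul fa gb) hc)// (below_lmul fa (below_lmul gb hc))//.
  by rewrite addrA.
pose m := absz (a + b + c - n)%R.
have -> : n = a + b + c - m%:Z by lia.
rewrite /= (lmul_funE _ (below_lmul fa gb) hc) -(addrA a b c).
rewrite (lmul_funE _ fa (below_lmul gb hc)).
transitivity (P a m.+1 f * (P b m.+1 g * P c m.+1 h))`_m.
  rewrite !coefM; apply: eq_bigr => -[i im] _ /=.
  by rewrite P_lmul// leq_subr.
rewrite mulrA coefM [RHS]coefM; apply: eq_bigr => -[i im] _ /=.
by rewrite P_lmul.
Qed.

Let lmulDl : left_distributive lmul +%R.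
Proof.
move=> f g h; apply: laurentP => n.
have [[a fa] [b gb] [c hc]] := And3 (below_ub f) (below_ub g) (below_ub h).
pose d := Num.max a b.
have fd : below d f by move=> i di; apply: fa; lia.
have gd : below d g by move=> i di; apply: gb; lia.
have fgd : below d (f + g).
  by move=> i di; rewrite lcoefD fd ?gd ?addr0.
rewrite lcoefD; have [abn|nab] := ltP (d + c) n.
  by rewrite !(below_lmul _ hc abn)// addr0.
have -> : n = d + c - (absz (d + c - n)%R)%:Z by lia.
rewrite /= !lmul_funE// -coefD -mulrDl; congr ((polyseq (_ * _))`_ _).
by apply/polyP => i; rewrite coefD !coefP lcoefD; case: ifP; rewrite ?addr0.
Qed.

Let lmulDr : right_distributive lmul +%R.
Proof.
move=> h f g; apply: laurentP => n.
have [[a fa] [b gb] [c hc]] := And3 (below_ub f) (below_ub g) (below_ub h).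
pose d := Num.max a b.
have fd : below d f by move=> i di; apply: fa; lia.
have gd : below d g by move=> i di; apply: gb; lia.
have fgd : below d (f + g).
  by move=> i di; rewrite lcoefD fd ?gd ?addr0.
rewrite lcoefD; have [abn|nab] := ltP (c + d) n.
  by rewrite !(below_lmul hc _ abn)// addr0.
have -> : n = c + d - (absz (c + d - n)%R)%:Z by lia.
rewrite /= !lmul_funE// -coefD -mulrDr; congr ((polyseq (_ * _))`_ _).
by apply/polyP => i; rewrite coefD !coefP lcoefD; case: ifP; rewrite ?addr0.
Qed.

Let fsbig_single (F : int -> A) (i : int) : (forall j, j != i -> F j = 0) ->
  \sum_(j \in [set: int]%classic) F j = F i.
Proof.
move=> Fi; rewrite (fsbigE [:: i])//.
  by rewrite big_mkcond big_seq1 in_setT.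
by move=> j _; rewrite inE => /Fi.
Qed.

Lemma lmul_monol n x f k : lmul (lmono n x) f k = x * f (k - n).
Proof.
rewrite /= /lmul_fun (@fsbig_single _ n)/= ?eqxx// => j /negPf->.
by rewrite mul0r.
Qed.

Lemma lmul_monor n x f k : lmul f (lmono n x) k = f (k - n) * x.
Proof.
rewrite /= /lmul_fun (@fsbig_single _ (k - n))/=.
  by rewrite subKr eqxx.
move=> j jkn; case: eqP => [E|_]; last by rewrite mulr0.
by move: jkn; rewrite -E subKr eqxx.
Qed.

Let lone := lmono 0 1.

Let lmul1f : left_id lone lmul.
Proof. by move=> f; apply: laurentP => n; rewrite lmul_monol mul1r subr0. Qed.

Let lmulf1 : right_id lone lmul.
Proof. by move=> f; apply: laurentP => n; rewrite lmul_monor mulr1 subr0. Qed.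

Let lone_neq0 : lone != 0.
Proof. by apply/eqP => /(congr1 (fun f : laurent A => f 0))/eqP; rewrite /= oner_eq0. Qed.

HB.instance Definition _ := GRing.Zmodule_isNzRing.Build (laurent A)
  lmulA lmul1f lmulf1 lmulDl lmulDr lone_neq0.

Lemma lcoefM f g n :
  (f * g) n = \sum_(i \in [set: int]%classic) f i * g (n - i).
Proof. by []. Qed.

Lemma lcoef_monol n x f k : (lmono n x * f) k = x * f (k - n).
Proof. exact: lmul_monol. Qed.

Lemma lcoef_monor n x f k : (f * lmono n x) k = f (k - n) * x.
Proof. exact: lmul_monor. Qed.

End LaurentRing.

Section LaurentLmodule.
Variables (F : pzRingType) (A : lmodType F).
Implicit Types (f g : laurent A).

Fact lscale_bounded (c : F) f : bounded_above_pred (fun n => c *: f n).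
Proof.
have [a fa] := laurent_bounded f.
by apply/asboolP; exists a => n /fa->; rewrite scaler0.
Qed.

Definition lscale c f := Laurent (lscale_bounded c f).

Let lscaleA a b f : lscale a (lscale b f) = lscale (a * b) f.
Proof. by apply: laurentP => n; rewrite /= scalerA. Qed.

Let lscale1 : left_id 1 lscale.
Proof. by move=> f; apply: laurentP => n; rewrite /= scale1r. Qed.

Let lscaleDr : right_distributive lscale +%R.
Proof. by move=> c f g; apply: laurentP => n; exact: scalerDr. Qed.

Let lscaleDl f : {morph lscale^~ f : a b / a + b}.
Proof. by move=> a b; apply: laurentP => n; exact: scalerDl. Qed.

HB.instance Definition _ := GRing.Zmodule_isLmodule.Build F (laurent A)
  lscaleA lscale1 lscaleDr lscaleDl.

Lemma lcoefZ c f n : (c *: f) n = c *: f n. Proof. by []. Qed.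

End LaurentLmodule.

Section LaurentLalgebra.
Variables (F : pzRingType) (A : lalgType F).
Implicit Types (f g : laurent A).

Let lscaleAl (c : F) f g : c *: (f * g) = (c *: f) * g.
Proof.
have E (h : laurent A) : c *: h = lmono 0 c%:A * h.
  by apply: laurentP => n; rewrite lcoefZ lcoef_monol subr0 -scalerAl mul1r.
by rewrite !E mulrA.
Qed.

HB.instance Definition _ := GRing.Lmodule_isLalgebra.Build F (laurent A) lscaleAl.

End LaurentLalgebra.

(* In A((u^-1))((v^-1)) = [laurent (laurent A)] the outer indeterminate is v:
   the coefficient of u^m v^n in f is [f n m].  [in_u s] is s(u), [in_v s] is
   s(v). *)
Section TwoVariables.
Variable A : nzRingType.

Definition in_u (s : laurent A) : laurent (laurent A) := lmono 0 s.

Fact in_v_bounded (s : laurent A) :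
  bounded_above_pred (fun n => lmono 0 (s n) : laurent A).
Proof.
have [a sa] := laurent_bounded s; apply/asboolP; exists a => n /sa sn0.
by apply: laurentP => m; rewrite sn0 /=; case: ifP.
Qed.

Definition in_v (s : laurent A) : laurent (laurent A) := Laurent (in_v_bounded s).

End TwoVariables.

(* A set S of relations is a set of pairs (x, y), read as x = y;
   [relation_ideal S] is the two-sided ideal generated by the x - y. *)
Inductive relation_ideal (A : nzRingType) (S : A -> A -> Prop) : A -> Prop :=
| relation_ideal_rel x y : S x y -> relation_ideal S (x - y)
| relation_ideal0 : relation_ideal S 0
| relation_idealD x y :
    relation_ideal S x -> relation_ideal S y -> relation_ideal S (x + y)
| relation_idealMl a x : relation_ideal S x -> relation_ideal S (a * x)
| relation_idealMr a x : relation_ideal S x -> relation_ideal S (x * a).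

(* The free algebra is the algebra of the free monoid of words on I. *)
Definition free_alg (F : fieldType) (I : choiceType) := {malg F[{fmonom I}]}.

HB.lock Definition free_gen (F : fieldType) (I : choiceType) (i : I) :
  free_alg F I := << fmu i >>.

Section Presentation.
Variables (F : fieldType) (I : choiceType).

Local Notation free_alg := (free_alg F I).

HB.instance Definition _ := GRing.Lalgebra.on free_alg.

Let malg_scaleAr (c : F) (x y : {malg F[{fmonom I}]}) :
  c *: (x * y) = x * (c *: y).
Proof.
apply/malgP => k.
rewrite mcoeffZ.
rewrite [RHS](@mcoeffMlw _ _ (msupp x) (msupp y) x (c *: y) k (fsubset_refl _) (msuppZ_le c y)).
rewrite mcoeffMl mulr_sumr; apply: eq_bigr => k1 _.
rewrite mulr_sumr; apply: eq_bigr => k2 _.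
by rewrite mcoeffZ mulrnAr mulrCA.
Qed.

Fact free_scaleAr (c : F) (x y : free_alg) : c *: (x * y) = x * (c *: y).
Proof. exact: malg_scaleAr. Qed.

HB.instance Definition _ :=
  GRing.LSemiAlgebra_isSemiAlgebra.Build F free_alg free_scaleAr.

Implicit Types (S : free_alg -> free_alg -> Prop).

(* (A, g) is the unital associative algebra with generators g_i (i in I) and
   defining relations S. *)
Definition presented_by (A : algType F) (g : I -> A) S : Prop :=
  exists phi : {lrmorphism free_alg -> A},
    [/\ forall i, phi (free_gen F i) = g i,
        forall a, exists x, phi x = a
      & forall x, phi x = 0 <-> relation_ideal S x].

Section PresentedAlgebra.
Variable S : free_alg -> free_alg -> Prop.

(* Library algebras are nonzero, whence this side condition. *)
Definition proper_relations := ~ relation_ideal S 1.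

Hypothesis S1 : proper_relations.

Definition ideal_pred & proper_relations : {pred free_alg} :=
  fun x => `[< relation_ideal S x >].

Fact ideal_zmod_closed : zmod_closed (ideal_pred S1).
Proof.
split=> [|x y /asboolP Sx /asboolP Sy]; apply/asboolP.
  exact: relation_ideal0.
apply: relation_idealD => //; rewrite -mulN1r; exact: relation_idealMl.
Qed.

HB.instance Definition _ :=
  GRing.isZmodClosed.Build free_alg (ideal_pred S1) ideal_zmod_closed.

Definition presented_alg := Quotient.quot (ideal_pred S1).

HB.instance Definition _ := GRing.Zmodule.on presented_alg.

Definition presented_pi : free_alg -> presented_alg := locked \pi_presented_alg.

Lemma presented_piP x y :
  presented_pi x = presented_pi y <-> relation_ideal S (x - y).
Proof.
split=> [/eqP|Sxy]; last apply/eqP.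
  by rewrite /presented_pi -lock -Quotient.idealrBE => /asboolP.
by rewrite /presented_pi -lock -Quotient.idealrBE; apply/asboolP.
Qed.

Lemma presented_reprK (a : presented_alg) : presented_pi (repr a) = a.
Proof. by rewrite /presented_pi -lock reprK. Qed.

Let piD : {morph presented_pi : x y / x + y}.
Proof. by move=> x y; rewrite /presented_pi -lock !piE. Qed.

Let pi_repr x : relation_ideal S (repr (presented_pi x) - x).
Proof. by apply/presented_piP; rewrite presented_reprK. Qed.

Let pi_mul (a b : presented_alg) := presented_pi (repr a * repr b).

Let piM x y : presented_pi (x * y) = pi_mul (presented_pi x) (presented_pi y).
Proof.
apply/esym/presented_piP; set x' := repr _; set y' := repr _.
have -> : x' * y' - x * y = (x' - x) * y' + x * (y' - y).
  by rewrite mulrBl mulrBr addrA subrK.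
by apply: relation_idealD;
  [apply: relation_idealMr|apply: relation_idealMl]; exact: pi_repr.
Qed.

Let pi_one := presented_pi 1.

Let pi_mulA : associative pi_mul.
Proof.
move=> a b c; rewrite -[a]presented_reprK -[b]presented_reprK -[c]presented_reprK.
move: (repr a) (repr b) (repr c) => x y z.
refine (etrans (congr1 (pi_mul _) (esym (piM y z))) _).
refine (etrans (esym (piM x (y * z))) _).
refine (etrans (congr1 presented_pi (mulrA x y z)) _).
refine (etrans (piM (x * y) z) _).
by rewrite (piM x y).
Qed.

Let pi_mul1 : left_id pi_one pi_mul.
Proof. by move=> a; rewrite -[a]presented_reprK -piM mul1r. Qed.

Let pi_mulr1 : right_id pi_one pi_mul.
Proof. by move=> a; rewrite -[a]presented_reprK -piM mulr1. Qed.

Let pi_mulDl : left_distributive pi_mul +%R.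
Proof.
move=> a b c; rewrite -[a]presented_reprK -[b]presented_reprK -[c]presented_reprK.
by rewrite -piD -!piM -piD mulrDl.
Qed.

Let pi_mulDr : right_distributive pi_mul +%R.
Proof.
move=> a b c; rewrite -[a]presented_reprK -[b]presented_reprK -[c]presented_reprK.
by rewrite -piD -!piM -piD mulrDr.
Qed.

Let pi0 : presented_pi 0 = 0.
Proof. by rewrite /presented_pi -lock piE. Qed.

Let pi_one_neq0 : pi_one != 0.
Proof. by apply/eqP; rewrite -pi0 => /presented_piP; rewrite subr0. Qed.

HB.instance Definition _ := GRing.Zmodule_isNzRing.Build presented_alg
  pi_mulA pi_mul1 pi_mulr1 pi_mulDl pi_mulDr pi_one_neq0.

Let pi_scale (c : F) (a : presented_alg) := presented_pi (c *: repr a).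

Let piZ c x : presented_pi (c *: x) = pi_scale c (presented_pi x).
Proof.
apply/esym/presented_piP; rewrite -scalerBr -[_ - x]mul1r scalerAl.
by apply: relation_idealMl; exact: pi_repr.
Qed.

Let pi_scaleA a b v : pi_scale a (pi_scale b v) = pi_scale (a * b) v.
Proof. rewrite -[v]presented_reprK; move: (repr v) => x.
refine (etrans (congr1 (pi_scale a) (esym (piZ b x))) _).
refine (etrans (esym (piZ a (b *: x))) _).
refine (etrans (congr1 presented_pi (scalerA a b x)) _).
exact (piZ (a * b) x). Qed.

Let pi_scale1 : left_id 1 pi_scale.
Proof. by move=> v; rewrite -[v]presented_reprK -piZ scale1r. Qed.

Let pi_scaleDr : right_distributive pi_scale +%R.
Proof.
move=> c v w; rewrite -[v]presented_reprK -[w]presented_reprK.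
by rewrite -piD -!piZ -piD scalerDr.
Qed.

Let pi_scaleDl v : {morph pi_scale^~ v : a b / a + b}.
Proof. by move=> a b; rewrite -[v]presented_reprK -!piZ -piD scalerDl. Qed.

HB.instance Definition _ := GRing.Zmodule_isLmodule.Build F presented_alg
  pi_scaleA pi_scale1 pi_scaleDr pi_scaleDl.

Let pi_scaleAl (c : F) (v w : presented_alg) : c *: (v * w) = (c *: v) * w.
Proof.
rewrite -[v]presented_reprK -[w]presented_reprK.
by rewrite -[LHS]/(pi_scale c (pi_mul _ _)) -piM -piZ scalerAl piM piZ.
Qed.

HB.instance Definition _ :=
  GRing.Lmodule_isLalgebra.Build F presented_alg pi_scaleAl.

Let pi_scaleAr (c : F) (v w : presented_alg) : c *: (v * w) = v * (c *: w).
Proof.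
rewrite -[v]presented_reprK -[w]presented_reprK.
by rewrite -[LHS]/(pi_scale c (pi_mul _ _)) -piM -piZ scalerAr piM piZ.
Qed.

HB.instance Definition _ :=
  GRing.LSemiAlgebra_isSemiAlgebra.Build F presented_alg pi_scaleAr.

Let piB : {morph presented_pi : x y / x - y}.
Proof. by move=> x y; rewrite /presented_pi -lock !piE. Qed.

HB.instance Definition _ := GRing.isZmodMorphism.Build free_alg presented_alg
  presented_pi piB.
Let pi_monoid : monoid_morphism presented_pi. Proof. exact: conj (erefl _) piM. Qed.

HB.instance Definition _ := GRing.isMonoidMorphism.Build free_alg presented_alg
  presented_pi pi_monoid.
HB.instance Definition _ := GRing.isScalable.Build F free_alg presented_alg
  *:%R presented_pi piZ.

Definition presented_gen (i : I) : presented_alg := presented_pi (free_gen F i).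

Lemma presented_algP : presented_by presented_gen S.
Proof.
exists presented_pi; split=> // [a|x]; first by exists (repr a); exact: presented_reprK.
by rewrite -[X in _ = X](raddf0 presented_pi) presented_piP subr0.
Qed.

End PresentedAlgebra.
End Presentation.

(* [Wneg k], [Wpos k], [Gplus k], [Gtilde k] stand for W_{-k}, W_{k+1},
   G_{k+1}, \tilde G_{k+1}. *)
Inductive alt_gen : predArgType :=
| Wneg of nat | Wpos of nat | Gplus of nat | Gtilde of nat.

Definition alt_gen_code (g : alt_gen) : nat * nat :=
  match g with
  | Wneg k => (0, k) | Wpos k => (1, k) | Gplus k => (2, k) | Gtilde k => (3, k)
  end%N.

Definition alt_gen_decode (c : nat * nat) : alt_gen :=
  match c with
  | (0, k) => Wneg k | (1, k) => Wpos k | (2, k) => Gplus k | (_, k) => Gtilde k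
  end%N.

Fact alt_gen_codeK : cancel alt_gen_code alt_gen_decode. Proof. by case. Qed.

HB.instance Definition _ := Choice.copy alt_gen (can_type alt_gen_codeK).

Definition rows_mx (R : pzRingType) (n : nat) (s : seq (seq R)) : 'M[R]_n :=
  \matrix_(i, j) nth 0 (nth [::] s i) j.

Definition qvar (K : fieldType) : {fraction {poly K}} := FracField.tofrac 'X.

Section Relations.
Variables (K : fieldType) (A : algType {fraction {poly K}}) (g : alt_gen -> A).

Local Notation Kq := {fraction {poly K}}.
Local Notation q := (qvar K).
Local Notation Wn k := (g (Wneg k)).
Local Notation Wp k := (g (Wpos k)).
Local Notation G k := (g (Gplus k)).
Local Notation Gt k := (g (Gtilde k)).

Definition comm (x y : A) : A := x * y - y * x.
Definition qcomm (x y : A) : A := q *: (x * y) - q^-1 *: (y * x).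

Inductive Aq_relations (rho : Kq) : A -> A -> Prop :=
| Aq_W0Wp k : Aq_relations rho (comm (Wn 0) (Wp k)) (comm (Wn k) (Wp 0))
| Aq_WnW1 k :
    Aq_relations rho (comm (Wn k) (Wp 0)) ((q + q^-1)^-1 *: (Gt k - G k))
| Aq_W0G k : Aq_relations rho (qcomm (Wn 0) (G k)) (qcomm (Gt k) (Wn 0))
| Aq_GtW0 k : Aq_relations rho (qcomm (Gt k) (Wn 0)) (rho *: Wn k.+1)
| Aq_GW1 k : Aq_relations rho (qcomm (G k) (Wp 0)) (qcomm (Wp 0) (Gt k))
| Aq_W1Gt k : Aq_relations rho (qcomm (Wp 0) (Gt k)) (rho *: Wp k.+1)
| Aq_WnWn k l : Aq_relations rho (comm (Wn k) (Wn l)) 0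
| Aq_WpWp k l : Aq_relations rho (comm (Wp k) (Wp l)) 0
| Aq_WnWp k l : Aq_relations rho (comm (Wn k) (Wp l) + comm (Wp k) (Wn l)) 0
| Aq_WnG k l : Aq_relations rho (comm (Wn k) (G l) + comm (G k) (Wn l)) 0
| Aq_WnGt k l : Aq_relations rho (comm (Wn k) (Gt l) + comm (Gt k) (Wn l)) 0
| Aq_WpG k l : Aq_relations rho (comm (Wp k) (G l) + comm (G k) (Wp l)) 0
| Aq_WpGt k l : Aq_relations rho (comm (Wp k) (Gt l) + comm (Gt k) (Wp l)) 0
| Aq_GG k l : Aq_relations rho (comm (G k) (G l)) 0
| Aq_GtGt k l : Aq_relations rho (comm (Gt k) (Gt l)) 0
| Aq_GtG k l : Aq_relations rho (comm (Gt k) (G l) + comm (G k) (Gt l)) 0.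

(* No relation has a constant term: an augmentation killing the generators
   kills the ideal. *)
Lemma Aq_relations_augmentation (rho : Kq) (eps : A -> Kq) :
    eps 0 = 0 -> {morph eps : x y / x + y} -> {morph eps : x y / x * y} ->
    (forall c, {morph eps : x / c *: x >-> c * x}) ->
    (forall i, eps (g i) = 0) ->
  forall x, relation_ideal (Aq_relations rho) x -> eps x = 0.
Proof.
move=> eps0 epsD epsM epsZ epsg.
have epsB x y : eps (x - y) = eps x - eps y.
  by rewrite -scaleN1r epsD epsZ mulN1r.
have epsc i j : eps (comm (g i) (g j)) = 0.
  by rewrite /comm epsB !epsM !epsg !mul0r subrr.
have epsqc i j : eps (qcomm (g i) (g j)) = 0.
  by rewrite /qcomm epsB !epsZ !epsM !epsg !mul0r !mulr0 subrr.
move=> z; elim=> [x y Sxy||x y _ ex _ ey|a x _ ex|a x _ ex].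
- suff [ex ey] : eps x = 0 /\ eps y = 0 by rewrite epsB ex ey subrr.
  case: Sxy => *; first [by rewrite epsD !epsc addr0 eps0
    | by rewrite !(epsc, epsqc, eps0)
    | by rewrite !(epsc, epsqc) epsZ ?epsB !epsg ?subrr mulr0].
- exact: eps0.
- by rewrite epsD ex ey addr0.
- by rewrite epsM ex mulr0.
- by rewrite epsM ex mul0r.
Qed.

Local Notation L1 := (laurent A).
Local Notation L2 := (laurent (laurent A)).

Local Notation z := (lmono 1 1 : L1).

(* U^-1, where U = q z^2 / (q + q^-1) *)
Definition Uinv : L1 := ((q + q^-1) / q) *: lmono (- 2%:Z) 1.

Lemma UinvX k : Uinv ^+ k = lmono (- (2 * k)%N%:Z) (((q + q^-1) / q) ^+ k)%:A.
Proof.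
elim: k => [|k IHk]; first by apply: laurentP => n; rewrite !expr0 scale1r.
apply: laurentP => n; rewrite exprS IHk /Uinv -scalerAl lcoefZ lcoef_monol mul1r /=.
rewrite (fun_if (fun x : A => _ *: x)) scalerA -exprS scaler0.
have -> // : (n - (- 2%:Z) == - (2 * k)%N%:Z) = (n == - (2 * k.+1)%N%:Z).
by apply/eqP/eqP; lia.
Qed.

(* \sum_(k >= 0) a_k U^(-k-1); each coefficient is a finite sum. *)
Definition Useries_fun (a : nat -> A) : int -> A :=
  fun n => \sum_(k \in [set: nat]%classic) (lmono 0 (a k) * Uinv ^+ k.+1) n.

Fact Useries_bounded a : bounded_above_pred (Useries_fun a).
Proof.
apply/asboolP; exists 0 => n n0; rewrite /Useries_fun fsbig1// => k _.
rewrite lcoef_monol UinvX /= subr0; case: eqP => [E|_]; last exact: mulr0.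
by move: n0; rewrite E; lia.
Qed.

Definition Useries (a : nat -> A) : L1 := Laurent (Useries_bounded a).

Definition Wplus_series : L1 := Useries (fun k => Wn k).
Definition Wminus_series : L1 := Useries (fun k => Wp k).
Definition Gplus_series : L1 := Useries (fun k => G k).
Definition Gminus_series : L1 := Useries (fun k => Gt k).

(* R(w), with winv standing for w^-1 *)
Definition Rmx (w winv : L2) : 'M[L2]_(2 * 2) := rows_mx (2 * 2)
  [:: [:: q *: w - q^-1 *: winv; 0; 0; 0];
      [:: 0; w - winv; (q - q^-1)%:A; 0];
      [:: 0; (q - q^-1)%:A; w - winv; 0];
      [:: 0; 0; 0; q *: w - q^-1 *: winv]].

Definition R0mx : 'M[L2]_(2 * 2) := rows_mx (2 * 2)
  [:: [:: 1; 0; 0; 0];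
      [:: 0; q^-1%:A; 0; 0];
      [:: 0; 0; q^-1%:A; 0];
      [:: 0; 0; 0; 1]].

Definition R_uv : 'M[L2]_(2 * 2) :=
  Rmx (in_u (lmono 1 1) * in_v (lmono (-1) 1))
      (in_u (lmono (-1) 1) * in_v (lmono 1 1)).

(* kp and km are k_+ and k_-. *)
Variables kp km : Kq.

Definition Kmx : 'M[L1]_2 := rows_mx 2
  [:: [:: q *: (z * Wplus_series);
          (km * (q + q^-1))^-1 *: Gplus_series
          + (kp * (q + q^-1) / (q - q^-1))%:A];
      [:: (kp * (q + q^-1))^-1 *: Gminus_series
          + (km * (q + q^-1) / (q - q^-1))%:A;
          q *: (z * Wminus_series)]].

Definition K_u : 'M[L2]_2 := map_mx (@in_u A) Kmx.
Definition K_v : 'M[L2]_2 := map_mx (@in_v A) Kmx.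

(* [*t] is the Kronecker product; row and column indices are in lexicographic
   order. *)
Definition FM_lhs : 'M[L2]_(2 * 2) :=
  R_uv *m (K_u *t 1%:M) *m R0mx *m (1%:M *t K_v).

Definition FM_rhs : 'M[L2]_(2 * 2) :=
  (1%:M *t K_v) *m R0mx *m (K_u *t 1%:M) *m R_uv.

(* equality of the coefficients of u^m v^n in the (i, j) entries *)
Inductive FM_relations : A -> A -> Prop :=
| FM_relation i j (m n : int) : FM_relations (FM_lhs i j n m) (FM_rhs i j n m).

End Relations.

Section AlternatingAlgebra.
Variable K : fieldType.

Local Notation Kq := {fraction {poly K}}.
Local Notation gen := (@free_gen Kq alt_gen).

Lemma Aq_proper (rho : Kq) : proper_relations (Aq_relations gen rho).
Proof.
pose eps (x : free_alg Kq alt_gen) : Kq := mcoeff (@mone {fmonom alt_gen}) x.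
have epsM : {morph eps : x y / x * y}.
  exact: (rmorphM (@mcoeff {fmonom alt_gen} Kq (@mone _))).
have epsg i : eps (gen i) = 0.
  rewrite free_gen.unlock /eps mcoeffU1 -[_ == _]/(fmu i == fmone _).
  by rewrite fmuE fmoneE.
have eps0 : eps 0 = 0 by exact: mcoeff0.
have epsD : {morph eps : x y / x + y} by exact: mcoeffD.
have epsZ c : {morph eps : x / c *: x >-> c * x} by move=> x; exact: mcoeffZ.
have eps1 : eps 1 = 1 by rewrite /eps mcoeff1 eqxx.
move=> /(Aq_relations_augmentation eps0 epsD epsM epsZ epsg)/eqP.
by rewrite eps1 oner_eq0.
Qed.

Definition Aq (rho : Kq) : algType Kq := presented_alg (@Aq_proper rho).

Definition Aq_gen (rho : Kq) (i : alt_gen) : Aq rho :=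
  presented_gen (@Aq_proper rho) i.

Lemma AqP (rho : Kq) : presented_by (@Aq_gen rho) (Aq_relations gen rho).
Proof. exact: presented_algP. Qed.

End AlternatingAlgebra.

(* Main.v *)
From HB Require Import structures.
Require Import Defs.
From mathcomp Require Import all_boot all_order all_algebra.
From mathcomp Require Import mxtens.
From mathcomp Require Import boolp classical_sets fsbigop.
From mathcomp Require Import zify ring.
Set Implicit Arguments.
Unset Strict Implicit.
Unset Printing Implicit Defensive.
Import Order.TTheory GRing.Theory Num.Theory.
Local Open Scope ring_scope.

(* Write a_i, d_i for the coefficients of u^(1-2i) in the diagonal entries of K(u),
   and b_i, c_i for those of u^(-2i) in the entries (1,2) and (2,1); then b_0 and
   c_0 are nonzero scalars while a_0 = d_0 = 0. The matrix equation becomes sixteen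
   families of relations indexed by i and j. Setting i = 0 in them gives the
   relations of the alternating presentation that are q-commutators with W_0 or
   W_1, and eliminating between them shows that brackets such as [a_i, d_j] or
   [b_i, c_j] are symmetric in i and j. Conversely, b_0 being invertible, a_(i+1)
   is a multiple of q a_1 b_i - q^-1 b_i a_1, so each of the sixteen families
   amounts to the symmetry in i and j of an expression that the alternating
   relations show to be symmetric. Hence the two sets of relations hold in the same
   algebras, and generate the same ideal of the free algebra. *)

(** * Normal forms of noncommutative polynomials *)

Inductive ncterm (F : Type) :=
| NcVar of nat
| Nc0
| Nc1
| NcAdd of ncterm F & ncterm F
| NcOpp of ncterm F
| NcMul of ncterm F & ncterm F
| NcScale of F & ncterm F.

Arguments NcVar {F}.
Arguments Nc0 {F}.
Arguments Nc1 {F}.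

Fixpoint same_word (v w : seq nat) : bool :=
  match v, w with
  | [::], [::] => true
  | i :: v', j :: w' => Nat.eqb i j && same_word v' w'
  | _, _ => false
  end.

Lemma same_wordP v w : same_word v w -> v = w.
Proof.
elim: v w => [|i v IHv] [|j w]//= /andP[/PeanoNat.Nat.eqb_eq -> /IHv ->//].
Qed.

Section NcNormalForm.
Variables (F : comNzRingType) (A : algType F) (env : seq A).

Fixpoint nceval (t : ncterm F) : A :=
  match t with
  | NcVar i => env`_i
  | Nc0 => 0
  | Nc1 => 1
  | NcAdd s t => nceval s + nceval t
  | NcOpp t => - nceval t
  | NcMul s t => nceval s * nceval t
  | NcScale c t => c *: nceval t
  end.

Definition word_eval (w : seq nat) : A := foldr (fun i x => env`_i * x) 1 w.

Fixpoint ncpoly_eval (p : seq (F * seq nat)) : A :=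
  if p is m :: p' then m.1 *: word_eval m.2 + ncpoly_eval p' else 0.

Fixpoint ncscale (c : F) (p : seq (F * seq nat)) : seq (F * seq nat) :=
  if p is m :: p' then (c * m.1, m.2) :: ncscale c p' else [::].

Fixpoint ncinsert (c : F) (w : seq nat) (p : seq (F * seq nat)) :
    seq (F * seq nat) :=
  if p is m :: p' then
    if same_word w m.2 then (c + m.1, w) :: p' else m :: ncinsert c w p'
  else [:: (c, w)].

Fixpoint ncadd (p r : seq (F * seq nat)) : seq (F * seq nat) :=
  if p is m :: p' then ncinsert m.1 m.2 (ncadd p' r) else r.

Fixpoint ncmulw (c : F) (w : seq nat) (p : seq (F * seq nat)) :
    seq (F * seq nat) :=
  if p is m :: p' then (c * m.1, cat w m.2) :: ncmulw c w p' else [::].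

Fixpoint ncmul (p r : seq (F * seq nat)) : seq (F * seq nat) :=
  if p is m :: p' then ncadd (ncmulw m.1 m.2 r) (ncmul p' r) else [::].

(** Words are compared and merged, but coefficients are only combined formally: a zero coefficient
    is kept, so the computation never decides an equality in [F]. *)
Fixpoint ncnorm (t : ncterm F) : seq (F * seq nat) :=
  match t with
  | NcVar i => [:: (1, [:: i])]
  | Nc0 => [::]
  | Nc1 => [:: (1, [::])]
  | NcAdd s t => ncadd (ncnorm s) (ncnorm t)
  | NcOpp t => ncscale (-1) (ncnorm t)
  | NcMul s t => ncmul (ncnorm s) (ncnorm t)
  | NcScale c t => ncscale c (ncnorm t)
  end.

Fixpoint ncvanish (p : seq (F * seq nat)) : Prop :=
  if p is m :: p' then m.1 = 0 /\ ncvanish p' else True.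

Let word_eval_cat v w : word_eval (cat v w) = word_eval v * word_eval w.
Proof. by elim: v => [|i v IHv] /=; rewrite ?mul1r// IHv mulrA. Qed.

Let ncscaleE c p : ncpoly_eval (ncscale c p) = c *: ncpoly_eval p.
Proof. by elim: p => [|m p IHp] /=; rewrite ?scaler0// IHp scalerDr scalerA. Qed.

Let ncinsertE c w p :
  ncpoly_eval (ncinsert c w p) = c *: word_eval w + ncpoly_eval p.
Proof.
elim: p => [|m p IHp]//=; case: ifP => [/same_wordP->|_] /=.
  by rewrite scalerDl addrA.
by rewrite IHp addrCA.
Qed.

Let ncaddE p r : ncpoly_eval (ncadd p r) = ncpoly_eval p + ncpoly_eval r.
Proof. by elim: p => [|m p IHp] /=; rewrite ?add0r// ncinsertE IHp addrA. Qed.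

Let ncmulwE c w p :
  ncpoly_eval (ncmulw c w p) = c *: (word_eval w * ncpoly_eval p).
Proof.
elim: p => [|m p IHp] /=; first by rewrite mulr0 scaler0.
by rewrite IHp mulrDr scalerDr word_eval_cat -scalerAr scalerA.
Qed.

Let ncmulE p r : ncpoly_eval (ncmul p r) = ncpoly_eval p * ncpoly_eval r.
Proof.
elim: p => [|m p IHp] /=; first by rewrite mul0r.
by rewrite ncaddE ncmulwE IHp mulrDl scalerAl.
Qed.

Let ncnormE t : ncpoly_eval (ncnorm t) = nceval t.
Proof.
elim: t => [i|||s IHs t IHt|t IHt|s IHs t IHt|c t IHt] //=.
- by rewrite scale1r mulr1 addr0.
- by rewrite scale1r addr0.
- by rewrite ncaddE IHs IHt.
- by rewrite ncscaleE IHt scaleN1r.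
- by rewrite ncmulE IHs IHt.
- by rewrite ncscaleE IHt.
Qed.

(** Soundness by reflection: the normal form has the value of the term it comes from, and a list of
    zero coefficients has value 0. Equal words having been merged, the hypothesis is one identity in
    [F] per word. *)
Lemma nceval_eq s t : ncvanish (ncnorm (NcAdd s (NcOpp t))) -> nceval s = nceval t.
Proof.
move=> st; apply/eqP; rewrite -subr_eq0; apply/eqP.
rewrite -[LHS]/(nceval (NcAdd s (NcOpp t))) -ncnormE.
move: st; elim: (ncnorm _) => [|m p IHp]//= [-> /IHp->].
by rewrite scale0r addr0.
Qed.

End NcNormalForm.

Ltac nc_index x env :=
  lazymatch env with
  | x :: _ => constr:(O)
  | _ :: ?env' => let n := nc_index x env' in constr:(S n)
  end.

Ltac nc_insert x env :=
  match env with
  | [::] => constr:(x :: env)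
  | x :: _ => env
  | ?y :: ?env' => let e := nc_insert x env' in constr:(y :: e)
  end.

Ltac nc_env t env :=
  lazymatch t with
  | @GRing.add _ ?x ?y => let e := nc_env x env in nc_env y e
  | @GRing.opp _ ?x => nc_env x env
  | @GRing.mul _ ?x ?y => let e := nc_env x env in nc_env y e
  | @GRing.scale _ _ _ ?x => nc_env x env
  | @GRing.zero _ => env
  | @GRing.one _ => env
  | _ => nc_insert t env
  end.

Ltac nc_reify F t env :=
  lazymatch t with
  | @GRing.add _ ?x ?y =>
    let s := nc_reify F x env in let r := nc_reify F y env in
    constr:(@NcAdd F s r)
  | @GRing.opp _ ?x => let s := nc_reify F x env in constr:(@NcOpp F s)
  | @GRing.mul _ ?x ?y =>
    let s := nc_reify F x env in let r := nc_reify F y env in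
    constr:(@NcMul F s r)
  | @GRing.scale _ _ ?c ?x =>
    let s := nc_reify F x env in constr:(@NcScale F c s)
  | @GRing.zero _ => constr:(@Nc0 F)
  | @GRing.one _ => constr:(@Nc1 F)
  | _ => let n := nc_index t env in constr:(@NcVar F n)
  end.

Ltac nc_split tac :=
  lazymatch goal with
  | |- True => exact I
  | |- _ /\ _ => split; [tac | nc_split tac]
  end.

(* Reduces an identity in the [F]-algebra [A] between noncommutative polynomials
   to the vanishing of the coefficient of each word; [tac] proves the latter. *)
Ltac nc_solve F A tac :=
  lazymatch goal with
  | |- ?l = ?r =>
    let env := nc_env l (@nil A) in
    let env := nc_env r env in
    let s := nc_reify F l env in
    let t := nc_reify F r env in
    refine (@nceval_eq _ A env s t _);
    lazy [ncnorm ncvanish ncscale ncinsert ncadd ncmulw ncmul same_word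
          Nat.eqb cat fst snd andb];
    nc_split tac
  end.

(** * Exchange relations against alternating relations, for sequences in an algebra *)

Section TwistedCommutators.
Variables (F : fieldType) (A : algType F).
Implicit Types (x b : int -> A) (t : F).

Definition commutator (x y : A) : A := x * y - y * x.
Definition qcommutator t (x y : A) : A := t *: (x * y) - t^-1 *: (y * x).

Definition symmetric_on (f : int -> int -> A) := forall i j : int, f i j = f j i.

(** The sequences below are indexed by all integers and vanish at negative ones, so the base case is
    a whole half-line. *)
Lemma int_ind_up (P : int -> Prop) :
  (forall i : int, i <= 0 -> P i) -> (forall i, P i -> P (i + 1)) -> forall i, P i.
Proof.
move=> P0 PS i; have [/P0//|i0] := leP i 0.
rewrite (_ : i = `|i|%N%:Z); last by lia.
by elim: `|i|%N => [|n /PS]; [apply: P0 | rewrite (_ : n%:Z + 1 = n.+1%:Z)//; lia].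
Qed.

(* The antisymmetric part of f is constant along i + j, and vanishes for i = 0. *)
Lemma shift_symmetric (f : int -> int -> A) :
    (forall i j : int, i <= 0 -> f i j = f j i) ->
    (forall i j : int, (f (i + 1) j - f i (j + 1)) + (f (j + 1) i - f j (i + 1)) = 0) ->
  symmetric_on f.
Proof.
move=> f0 fS; elim/int_ind_up => [i i0 j|i IHi j]; first exact: f0.
have /eqP := fS i j; rewrite -(IHi (j + 1)).
rewrite (_ : _ + _ = f (i + 1) j - f j (i + 1)).
  by rewrite subr_eq0 => /eqP.
by rewrite addrA subrK.
Qed.

Section TwistSystem.
Variables (t be : F) (x b : int -> A).
Hypotheses (t0 : t != 0) (tt0 : t - t^-1 != 0) (be0 : be != 0).
Hypothesis x_le0 : forall i : int, i <= 0 -> x i = 0.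
Hypothesis b_0 : b 0 = be%:A.
Hypothesis bC : forall i j : int, commutator (b i) (b j) = 0.

Local Notation s := (t - t^-1).

(** The two entries of the matrix equation that mix one diagonal sequence x with one off-diagonal
    sequence b. The parameter t is q for the pairs (a, b) and (d, c), and q^-1 for (a, c) and (d,
    b). *)
Definition twist_exchange :=
  (forall i j : int, qcommutator t (x (i + 1)) (b j) =
     t^-1 *: commutator (x i) (b (j + 1)) + s *: (x (j + 1) * b i)) /\
  (forall i j : int, qcommutator t (x (i + 1)) (b j) =
     t *: commutator (x i) (b (j + 1)) + s *: (b i * x (j + 1))).

Definition twist_recursion :=
  (forall j : int, qcommutator t (x 1) (b j) = (s * be) *: x (j + 1)) /\
  symmetric_on (fun i j : int => commutator (x i) (b j)).

Let sbe0 : s * be != 0. Proof. by rewrite mulf_neq0. Qed.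

(** Up to a nonzero scalar, x_(i+1) is [x_1, b_i]_t. The antisymmetric part in i and j of
    [[x_1, b_i]_t, b_j]_t involves only [b_i, b_j], which is 0. *)
Lemma twist_qcommutator_symmetric : twist_recursion ->
  symmetric_on (fun i j : int => qcommutator t (x (i + 1)) (b j)).
Proof.
move=> [xS _] i j; apply: (scalerI sbe0).
transitivity (qcommutator t (qcommutator t (x 1) (b i)) (b j)).
  by rewrite xS /qcommutator; nc_solve F A ltac:(field).
transitivity (qcommutator t (qcommutator t (x 1) (b j)) (b i)); last first.
  by rewrite xS /qcommutator; nc_solve F A ltac:(field).
apply/eqP; rewrite -subr_eq0; apply/eqP.
transitivity (t ^+ 2 *: (x 1 * commutator (b i) (b j)) -
              t ^- 2 *: (commutator (b i) (b j) * x 1)).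
  by rewrite /qcommutator /commutator; nc_solve F A ltac:(field).
by rewrite bC mulr0 mul0r !scaler0 subrr.
Qed.

Lemma twist_exchangeP : twist_exchange <-> twist_recursion.
Proof.
split=> [[L R]|rec].
  (* At i = 0 the commutator drops out since x_0 = 0, and b_0 is the scalar [be]. *)
  split=> [j|]; first by rewrite -{1}[1]add0r L x_le0// b_0 /commutator mul0r mulr0
    subrr scaler0 add0r -scalerAr mulr1 scalerA.
  (* The two families share their left side, and their right sides differ by (t - t^-1)
     ([x_i, b_(j+1)] - [x_(j+1), b_i]). *)
  have xb i j : commutator (x i) (b (j + 1)) = commutator (x (j + 1)) (b i).
    apply: (scalerI tt0); apply/eqP; rewrite -subr_eq0; apply/eqP.
    transitivity (t *: commutator (x i) (b (j + 1)) + s *: (b i * x (j + 1)) -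
      (t^-1 *: commutator (x i) (b (j + 1)) + s *: (x (j + 1) * b i))).
      by rewrite /commutator; nc_solve F A ltac:(field).
    by rewrite -R -L subrr.
  by move=> i j; rewrite -(subrK 1 j) xb.
(* Once [x_i, b_(j+1)] is replaced by [x_(j+1), b_i], both right sides collapse to [x_(j+1), b_i]_t,
   so both families express the symmetry of [x_(i+1), b_j]_t. *)
have qxb := twist_qcommutator_symmetric rec; case: rec => _ xb.
split=> i j; rewrite qxb (xb i (j + 1)) /qcommutator /commutator;
  nc_solve F A ltac:(field; rewrite ?t0 //).
Qed.

End TwistSystem.

Definition corner_exchange (q : F) x :=
  forall i j : int, q *: commutator (x (i + 1)) (x j) = q^-1 *: commutator (x i) (x (j + 1)).

(** The relation carries the vanishing of [x_i, x_j] for all j from i to i + 1; the induction starts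
    at negative i, where x_i = 0. *)
Lemma corner_exchangeP (q : F) x : q != 0 -> (forall i : int, i < 0 -> x i = 0) ->
  corner_exchange q x <-> forall i j : int, commutator (x i) (x j) = 0.
Proof.
move=> q0 x_lt0; split=> [xx|xx i j]; last by rewrite !xx !scaler0.
have x0 i j : i < 0 -> commutator (x i) (x j) = 0.
  by move=> i0; rewrite /commutator x_lt0// mul0r mulr0 subrr.
elim/int_ind_up => [i i0|i IHi] j; apply: (scalerI q0); last by rewrite xx IHi !scaler0.
by rewrite -(subrK 1 i) xx x0 ?scaler0//; lia.
Qed.

Section AlternatingSystem.
Variables (q be ch : F) (a b c d : int -> A).

Local Notation e := (q - q^-1).
Local Notation lam := (e * be).
Local Notation mu := (e * ch).

(** With [offdiagonal_exchange], the four entries in the central 2 by 2 block of the matrix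
    equation, the only ones that involve all four sequences. *)
Definition diagonal_exchange :=
  (forall i j : int, commutator (a (i + 1)) (d j) - commutator (a i) (d (j + 1)) =
     (q * e) *: (c j * b i - c i * b j)) /\
  (forall i j : int, commutator (d (i + 1)) (a j) - commutator (d i) (a (j + 1)) =
     (q * e) *: (b j * c i - b i * c j)).

Definition offdiagonal_exchange :=
  (forall i j : int, commutator (b (i + 1)) (c j) - commutator (b i) (c (j + 1)) =
     (e / q) *: (d (j + 1) * a (i + 1) - d (i + 1) * a (j + 1))) /\
  (forall i j : int, commutator (c (i + 1)) (b j) - commutator (c i) (b (j + 1)) =
     (e / q) *: (a (j + 1) * d (i + 1) - a (i + 1) * d (j + 1))).

(* The matrix equation, in terms of a i = [u^(1-2i)] K_11, b i = [u^(-2i)] K_12,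
   c i = [u^(-2i)] K_21 and d i = [u^(1-2i)] K_22. *)
Record fm_system : Prop := FmSystem {
  fm_aa : corner_exchange q a;
  fm_bb : corner_exchange q b;
  fm_cc : corner_exchange q c;
  fm_dd : corner_exchange q d;
  fm_ab : twist_exchange q a b;
  fm_ac : twist_exchange q^-1 a c;
  fm_db : twist_exchange q^-1 d b;
  fm_dc : twist_exchange q d c;
  fm_diag : diagonal_exchange;
  fm_offdiag : offdiagonal_exchange }.

(** A field with [symmetric_on] encodes relations of the form [X_k, Y_l] + [Y_k, X_l] = 0. The
    scalars [lam] and [mu] are (q - q^-1) b_0 and (q - q^-1) c_0. *)
Record alt_system : Prop := AltSystem {
  alt_aa : forall i j : int, commutator (a i) (a j) = 0;
  alt_bb : forall i j : int, commutator (b i) (b j) = 0;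
  alt_cc : forall i j : int, commutator (c i) (c j) = 0;
  alt_dd : forall i j : int, commutator (d i) (d j) = 0;
  alt_ab : twist_recursion q be a b;
  alt_ac : twist_recursion q^-1 ch a c;
  alt_db : twist_recursion q^-1 be d b;
  alt_dc : twist_recursion q ch d c;
  alt_ad : symmetric_on (fun i j : int => commutator (a i) (d j));
  alt_bc : symmetric_on (fun i j : int => commutator (b i) (c j));
  alt_a1 : forall j : int, commutator (a 1) (d j) = q *: (lam *: c j - mu *: b j);
  alt_d1 : forall j : int, commutator (a j) (d 1) = q *: (lam *: c j - mu *: b j) }.

Hypotheses (q0 : q != 0) (e0 : e != 0) (be0 : be != 0) (ch0 : ch != 0).
Hypothesis a_le0 : forall i : int, i <= 0 -> a i = 0.
Hypothesis d_le0 : forall i : int, i <= 0 -> d i = 0.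
Hypothesis b_lt0 : forall i : int, i < 0 -> b i = 0.
Hypothesis c_lt0 : forall i : int, i < 0 -> c i = 0.
Hypothesis b_0 : b 0 = be%:A.
Hypothesis c_0 : c 0 = ch%:A.

Let a_lt0 (i : int) : i < 0 -> a i = 0. Proof. by move/ltW/a_le0. Qed.
Let d_lt0 (i : int) : i < 0 -> d i = 0. Proof. by move/ltW/d_le0. Qed.

Let qV0 : q^-1 != 0. Proof. by rewrite invr_eq0. Qed.

Let eV0 : q^-1 - q^-1^-1 != 0.
Proof. by rewrite invrK -opprB oppr_eq0. Qed.

Let lam0 : lam != 0. Proof. by rewrite mulf_neq0. Qed.

(** In its uses, z is a combination of expressions that vanish by known relations. Then x - y = z is
    an identity of free noncommutative polynomials, left to the normal form, and z certifies x =
    y. *)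
Let by_difference (x y z : A) : x - y = z -> z = 0 -> x = y.
Proof. by move=> <- /eqP; rewrite subr_eq0 => /eqP. Qed.

(** The right sides of [diagonal_exchange] and [offdiagonal_exchange] are antisymmetric in i and j,
    so [shift_symmetric] applies to [a_i, d_j] and [b_i, c_j]. Setting i = 0 in [diagonal_exchange]
    gives [alt_a1] and [alt_d1]. *)
Lemma fm_alt_system : fm_system -> alt_system.
Proof.
case=> aa bb cc dd ab ac db dc [ad da] [bc cb].
have bC := (corner_exchangeP q0 b_lt0).1 bb.
have cC := (corner_exchangeP q0 c_lt0).1 cc.
split.
- exact: (corner_exchangeP q0 a_lt0).1 aa.
- exact: bC.
- exact: cC.
- exact: (corner_exchangeP q0 d_lt0).1 dd.
- exact/(twist_exchangeP q0 e0 be0 a_le0 b_0 bC).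
- exact/(twist_exchangeP qV0 eV0 ch0 a_le0 c_0 cC).
- exact/(twist_exchangeP qV0 eV0 be0 d_le0 b_0 bC).
- exact/(twist_exchangeP q0 e0 ch0 d_le0 c_0 cC).
- apply: shift_symmetric => [i j i0|i j].
    by rewrite /commutator a_le0// (d_le0 i0) !mul0r !mulr0.
  by rewrite !ad -scalerDr -[X in _ *: X]/(_ - _ + (_ - _)) addrC addrA subrK subrr scaler0.
- apply: shift_symmetric => [i j i0|i j].
    (* The index 0 is apart: b_0 and c_0 do not vanish, but as scalars they commute with
       everything. *)
    have [i1|ineq0] := eqVneq i 0; last first.
      have {ineq0} i0 : i < 0 by lia.
      by rewrite /commutator b_lt0 ?(c_lt0 i0) ?mul0r ?mulr0.
    by rewrite i1 b_0 c_0 /commutator; nc_solve F A ltac:(ring).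
  by rewrite !bc -scalerDr addrA subrK subrr scaler0.
- move=> j; have := ad 0 j; rewrite add0r (@a_le0 0)// b_0 c_0 => adj.
  apply: (by_difference (z := commutator (a 1) (d j) - commutator 0 (d (j + 1)) -
    (q * e) *: (c j * be%:A - ch%:A * b j))); last by rewrite adj subrr.
  by rewrite /commutator; nc_solve F A ltac:(ring).
- move=> j; have := da 0 j; rewrite add0r (@d_le0 0)// b_0 c_0 => daj.
  apply: (by_difference (z := - (commutator (d 1) (a j) - commutator 0 (a (j + 1)) -
    (q * e) *: (b j * ch%:A - be%:A * c j)))); last by rewrite daj subrr oppr0.
  by rewrite /commutator; nc_solve F A ltac:(ring).
Qed.

Section Converse.
Hypothesis alt : alt_system.

(** The common value of [a_1, d_j] and [a_j, d_1]. *)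
Let P j := q *: (lam *: c j - mu *: b j).

Let bC i j : commutator (b i) (b j) = 0 := alt_bb alt i j.
Let a1E j : commutator (a 1) (d j) = P j := alt_a1 alt j.
Let d1E j : commutator (a j) (d 1) = P j := alt_d1 alt j.
Let ad i j : commutator (a i) (d j) = commutator (a j) (d i) := alt_ad alt i j.
Let bc i j : commutator (b i) (c j) = commutator (b j) (c i) := alt_bc alt i j.
Let ab i j : commutator (a i) (b j) = commutator (a j) (b i) := (alt_ab alt).2 i j.
Let db i j : commutator (d i) (b j) = commutator (d j) (b i) := (alt_db alt).2 i j.
Let qab j : qcommutator q (a 1) (b j) = lam *: a (j + 1) := (alt_ab alt).1 j.
Let qdb j : qcommutator q^-1 (d 1) (b j) = ((q^-1 - q^-1^-1) * be) *: d (j + 1) :=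
  (alt_db alt).1 j.

(** The bracket [b_i, P_j] is q lam [b_i, c_j] up to a multiple of [b_i, b_j] = 0, and [b_i, c_j] is
    symmetric. *)
Let bP i j : commutator (b i) (P j) = commutator (b j) (P i).
Proof.
apply: (by_difference (z := (q * lam) *: (commutator (b i) (c j) - commutator (b j) (c i))
     - (q * mu *+ 2) *: commutator (b i) (b j))).
  by rewrite /P /commutator; nc_solve F A ltac:(ring).
by rewrite bc subrr bC !scaler0 subrr.
Qed.

(* Up to terms symmetric in k and l, both sides of E are q [[a_1, b_k], d_l]; the
   Jacobi identity moves a_1 outside. *)
Let diag_symmetric i j :
  lam *: commutator (a (i + 1)) (d j) - e *: (b i * P j) =
  lam *: commutator (a (j + 1)) (d i) - e *: (b j * P i).
Proof.
suff E k l : lam *: commutator (a (k + 1)) (d l) - e *: (b k * P l) =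
    - (q *: (commutator (a 1) (commutator (d l) (b k)) + commutator (b k) (P l)) +
       e *: (commutator (d l) (b k) * a 1)).
  by rewrite !E db bP.
pose delta := commutator (a 1) (d l) - P l.
apply: (by_difference (z := commutator (lam *: a (k + 1) - qcommutator q (a 1) (b k)) (d l)
    + e *: (b k * delta) - q *: commutator (b k) delta)).
  by rewrite /delta /qcommutator /commutator; nc_solve F A ltac:(field; rewrite ?q0 //).
by rewrite /delta a1E qab !subrr /commutator !(mulr0, mul0r, subrr, scaler0, addr0).
Qed.

(** By [diag_symmetric], lam times the left side is e (b_i P_j - b_j P_i). Expanding P leaves a
    multiple of b_i c_j - b_j c_i, which equals c_j b_i - c_i b_j because [b_i, c_j] is
    symmetric. *)
Lemma alt_diag12 i j :
  commutator (a (i + 1)) (d j) - commutator (a i) (d (j + 1)) =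
     (q * e) *: (c j * b i - c i * b j).
Proof.
apply: (scalerI lam0); rewrite (ad i).
apply: (by_difference (z := (lam *: commutator (a (i + 1)) (d j) - e *: (b i * P j)) -
   (lam *: commutator (a (j + 1)) (d i) - e *: (b j * P i)) +
   (q * e * lam) *: (commutator (b i) (c j) - commutator (b j) (c i))
   - (q * e * mu) *: commutator (b i) (b j))).
  by rewrite /P /commutator; nc_solve F A ltac:(ring).
by rewrite diag_symmetric bc bC !subrr !scaler0 !addr0 subr0.
Qed.

Lemma alt_diagonal_exchange : diagonal_exchange.
Proof.
split=> i j; first exact: alt_diag12.
(* This is the first family with i and j exchanged, its products of b and c reordered by the
   symmetry of [b_i, c_j]. *)
apply: (by_difference (z :=
   commutator (a (j + 1)) (d i) - commutator (a j) (d (i + 1)) -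
     (q * e) *: (c i * b j - c j * b i)
   - (q * e) *: (commutator (b j) (c i) - commutator (b i) (c j)))).
  by rewrite /commutator; nc_solve F A ltac:(ring).
by rewrite alt_diag12 bc !subrr scaler0 subr0.
Qed.

(** In E, the recursion for d and P_(l+1) = [a_(l+1), d_1] leave an expression that depends on k and
    l only through [a_(l+1), d_(k+1)] and [a_(l+1), b_k]_q, both symmetric. *)
Let offdiag_symmetric i j :
  commutator (b i) (P (j + 1)) - (e * lam) *: (d (i + 1) * a (j + 1)) =
  commutator (b j) (P (i + 1)) - (e * lam) *: (d (j + 1) * a (i + 1)).
Proof.
have qabS := twist_qcommutator_symmetric q0 e0 be0 bC (alt_ab alt).
suff E k l : commutator (b k) (P (l + 1)) - (e * lam) *: (d (k + 1) * a (l + 1)) =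
    (q * lam) *: commutator (a (l + 1)) (d (k + 1))
    - q *: commutator (qcommutator q (a (l + 1)) (b k)) (d 1)
    - e *: (d 1 * qcommutator q (a (l + 1)) (b k)).
  by rewrite !E ad qabS.
(* Both [delta] and [eta] vanish, by [d1E] and [qdb]; note that (q^-1 - q) be is -lam. *)
pose delta := P (l + 1) - commutator (a (l + 1)) (d 1).
pose eta := qcommutator q^-1 (d 1) (b k) - ((q^-1 - q^-1^-1) * be) *: d (k + 1).
apply: (by_difference (z := commutator (b k) delta + q^-1 *: (eta * a (l + 1))
    - q *: (a (l + 1) * eta))).
  by rewrite /delta /eta /qcommutator /commutator invrK; nc_solve F A ltac:(field; rewrite ?q0 //).
by rewrite /delta /eta d1E qdb !subrr /commutator !(mulr0, mul0r, subrr, scaler0, addr0).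
Qed.

(** Since the b commute, q lam [b_i, c_j] is [b_i, P_j]. Multiplying by q lam therefore reduces the
    claim to [offdiag_symmetric]. *)
Lemma alt_offdiag12 i j :
  commutator (b (i + 1)) (c j) - commutator (b i) (c (j + 1)) =
     (e / q) *: (d (j + 1) * a (i + 1) - d (i + 1) * a (j + 1)).
Proof.
apply: (scalerI (mulf_neq0 q0 lam0)); rewrite (bc (i + 1) j).
apply: (by_difference (z :=
   (commutator (b j) (P (i + 1)) - (e * lam) *: (d (j + 1) * a (i + 1))) -
   (commutator (b i) (P (j + 1)) - (e * lam) *: (d (i + 1) * a (j + 1))) +
   (q * mu) *: commutator (b j) (b (i + 1))
   - (q * mu) *: commutator (b i) (b (j + 1)))).
  by rewrite /P /commutator; nc_solve F A ltac:(field; rewrite ?q0 //).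
by rewrite offdiag_symmetric !bC subrr !scaler0 !addr0 subr0.
Qed.

Lemma alt_offdiagonal_exchange : offdiagonal_exchange.
Proof.
split=> i j; first exact: alt_offdiag12.
apply: (by_difference (z :=
   commutator (b (j + 1)) (c i) - commutator (b j) (c (i + 1)) -
     (e / q) *: (d (i + 1) * a (j + 1) - d (j + 1) * a (i + 1))
   - (e / q) *: (commutator (a (j + 1)) (d (i + 1)) - commutator (a (i + 1)) (d (j + 1))))).
  by rewrite /commutator; nc_solve F A ltac:(field; rewrite ?q0 //).
by rewrite alt_offdiag12 ad !subrr scaler0 subr0.
Qed.

Lemma alt_fm_system : fm_system.
Proof.
split.
- exact/(corner_exchangeP q0 a_lt0)/(alt_aa alt).
- exact/(corner_exchangeP q0 b_lt0)/(alt_bb alt).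
- exact/(corner_exchangeP q0 c_lt0)/(alt_cc alt).
- exact/(corner_exchangeP q0 d_lt0)/(alt_dd alt).
- exact/(twist_exchangeP q0 e0 be0 a_le0 b_0 bC)/(alt_ab alt).
- exact/(twist_exchangeP qV0 eV0 ch0 a_le0 c_0 (alt_cc alt))/(alt_ac alt).
- exact/(twist_exchangeP qV0 eV0 be0 d_le0 b_0 bC)/(alt_db alt).
- exact/(twist_exchangeP q0 e0 ch0 d_le0 c_0 (alt_cc alt))/(alt_dc alt).
- exact: alt_diagonal_exchange.
- exact: alt_offdiagonal_exchange.
Qed.

End Converse.

Lemma fm_systemP : fm_system <-> alt_system.
Proof. by split; [exact: fm_alt_system | exact: alt_fm_system]. Qed.

End AlternatingSystem.
End TwistedCommutators.

Lemma ord2_cases (i : 'I_2) : i = ord0 \/ i = lift ord0 ord0.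
Proof. by case: i => [[|[|]]// ?]; [left | right]; apply: val_inj. Qed.

(** * The sixteen entries of the matrix equation, sorted by parity of exponents *)

Section ExchangeCoefficients.
Variables (F : fieldType) (A : algType F) (q : F) (k : 'I_2 -> 'I_2 -> int -> A).

Definition twist_weight (i j : 'I_2) : F := if i == j then 1 else q^-1.

Definition exchange_left_term (i j i' j' : 'I_2) (n m : int) : A :=
  twist_weight i' j *: (k i i' m * k j j' n).

Definition exchange_right_term (i j i' j' : 'I_2) (n m : int) : A :=
  twist_weight i j' *: (k j j' n * k i i' m).

(** The coefficient of u^m v^n in row (i, j) and column (i', j') of the left side, where [k i j n]
    is the coefficient of z^n in K_ij. A factor u/v reads the coefficient at (n + 1, m - 1), a
    factor v/u the one at (n - 1, m + 1), and the entry q - q^-1 of R swaps i and j. *)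
Definition exchange_left (i j i' j' : 'I_2) (n m : int) : A :=
  if i == j then q *: exchange_left_term i j i' j' (n + 1) (m - 1) -
                 q^-1 *: exchange_left_term i j i' j' (n - 1) (m + 1)
  else exchange_left_term i j i' j' (n + 1) (m - 1)
       - exchange_left_term i j i' j' (n - 1) (m + 1)
       + (q - q^-1) *: exchange_left_term j i i' j' n m.

Definition exchange_right (i j i' j' : 'I_2) (n m : int) : A :=
  if i' == j' then q *: exchange_right_term i j i' j' (n + 1) (m - 1) -
                 q^-1 *: exchange_right_term i j i' j' (n - 1) (m + 1)
  else exchange_right_term i j i' j' (n + 1) (m - 1)
       - exchange_right_term i j i' j' (n - 1) (m + 1)
       + (q - q^-1) *: exchange_right_term i j j' i' n m.

Definition exchange (i j i' j' : 'I_2) := forall n m : int,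
  exchange_left i j i' j' n m = exchange_right i j i' j' n m.

(** Off-diagonal entries of K contain only the powers -2i, diagonal entries only the powers 1 -
    2i. *)
Definition even_exponent (i : int) : int := - (2 * i).
Definition odd_exponent (i : int) : int := 1 - 2 * i.

Variables (a b c d : int -> A).

Local Notation o0 := (ord0 : 'I_2).
Local Notation o1 := (lift ord0 (ord0 : 'I_1) : 'I_2).

Hypotheses (q0 : q != 0).
Hypotheses (ka : forall i : int, k o0 o0 (odd_exponent i) = a i)
  (ka0 : forall i : int, k o0 o0 (even_exponent i) = 0).
Hypotheses (kb : forall i : int, k o0 o1 (even_exponent i) = b i)
  (kb0 : forall i : int, k o0 o1 (odd_exponent i) = 0).
Hypotheses (kc : forall i : int, k o1 o0 (even_exponent i) = c i)
  (kc0 : forall i : int, k o1 o0 (odd_exponent i) = 0).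
Hypotheses (kd : forall i : int, k o1 o1 (odd_exponent i) = d i)
  (kd0 : forall i : int, k o1 o1 (even_exponent i) = 0).

(** Writing an odd number with index i + 1 places its two neighbours at the even indices i and i +
    1. *)
Let even_odd (n : int) :
  (exists i : int, n = even_exponent i) \/ (exists i : int, n = odd_exponent (i + 1)).
Proof.
have [n2|n2] := eqVneq (n %% 2)%Z 0.
  by left; exists (- (n %/ 2)%Z); rewrite /even_exponent; lia.
by right; exists (- (n %/ 2)%Z - 1); rewrite /odd_exponent; lia.
Qed.

Let even_up (i : int) : even_exponent i + 1 = odd_exponent i.
Proof. by rewrite /even_exponent /odd_exponent; ring. Qed.
Let even_down (i : int) : even_exponent i - 1 = odd_exponent (i + 1).
Proof. by rewrite /even_exponent /odd_exponent; ring. Qed.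
Let odd_up (i : int) : odd_exponent (i + 1) + 1 = even_exponent i.
Proof. by rewrite /even_exponent /odd_exponent; ring. Qed.
Let odd_down (i : int) : odd_exponent (i + 1) - 1 = even_exponent (i + 1).
Proof. by rewrite /even_exponent /odd_exponent; ring. Qed.

Let shiftE := (even_up, even_down, odd_up, odd_down).
Let kE := (ka, ka0, kb, kb0, kc, kc0, kd, kd0).

(** The scalar s, one of 1, q and q^-1, absorbs the weights q^-1 that come from R^(0). *)
Let scaled_eq (s : F) (u v x y : A) : u = v -> x - y = s *: (u - v) -> x = y.
Proof. by move=> -> /eqP; rewrite subrr scaler0 subr_eq0 => /eqP. Qed.

Ltac exchange_unfold :=
  rewrite /exchange_left /exchange_right /exchange_left_term /exchange_right_term
    /twist_weight /= ?shiftE ?kE.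

Ltac exchange_solve :=
  rewrite /commutator /qcommutator ?invrK; nc_solve F A ltac:(field; rewrite ?q0 //).

Ltac exchange_forward s E :=
  let h := fresh "h" in
  move: E; exchange_unfold => h; apply: (scaled_eq (s := s) h); exchange_solve.

(** An entry has a fixed parity in u and in v, so three of the four parity classes of (n, m) read 0
    = 0 and the last one is E. *)
Ltac exchange_backward s E :=
  let n := fresh "n" in let m := fresh "m" in let i := fresh "i" in
  let j := fresh "j" in
  move=> n m; have [[j ->]|[j ->]] := even_odd n; have [[i ->]|[i ->]] := even_odd m;
  exchange_unfold;
  first [ by rewrite ?(mulr0, mul0r, scaler0, addr0, subr0, subrr)
        | apply: (scaled_eq (s := s) (E i j)); exchange_solve
        | apply: (scaled_eq (s := s) (E j i)); exchange_solve ].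

Lemma exchange_aa : exchange o0 o0 o0 o0 <-> corner_exchange q a.
Proof.
split=> [E i j|E].
  exchange_forward (1 : F) (E (even_exponent j) (even_exponent i)).
exchange_backward (1 : F) E.
Qed.

Lemma exchange_bb : exchange o0 o0 o1 o1 <-> corner_exchange q b.
Proof.
split=> [E i j|E].
  exchange_forward q (E (odd_exponent (j + 1)) (odd_exponent (i + 1))).
exchange_backward q^-1 E.
Qed.

Lemma exchange_cc : exchange o1 o1 o0 o0 <-> corner_exchange q c.
Proof.
split=> [E i j|E].
  exchange_forward q (E (odd_exponent (j + 1)) (odd_exponent (i + 1))).
exchange_backward q^-1 E.
Qed.

Lemma exchange_dd : exchange o1 o1 o1 o1 <-> corner_exchange q d.
Proof.
split=> [E i j|E].
  exchange_forward (1 : F) (E (even_exponent j) (even_exponent i)).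
exchange_backward (1 : F) E.
Qed.


Lemma exchange_ab : (exchange o0 o0 o0 o1 /\ exchange o0 o0 o1 o0) <-> twist_exchange q a b.
Proof.
split=> [[E1 E2]|[E1 E2]].
  split=> i j.
    exchange_forward (1 : F) (E1 (odd_exponent (j + 1)) (even_exponent i)).
  exchange_forward q (E2 (even_exponent i) (odd_exponent (j + 1))).
split.
  exchange_backward (1 : F) E1.
exchange_backward q^-1 E2.
Qed.

Lemma exchange_ac : (exchange o0 o1 o0 o0 /\ exchange o1 o0 o0 o0) <-> twist_exchange q^-1 a c.
Proof.
split=> [[E1 E2]|[E2 E1]].
  split=> i j.
    exchange_forward q (E2 (even_exponent i) (odd_exponent (j + 1))).
  exchange_forward (1 : F) (E1 (odd_exponent (j + 1)) (even_exponent i)).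
split.
  exchange_backward (1 : F) E1.
exchange_backward q^-1 E2.
Qed.

Lemma exchange_db : (exchange o1 o0 o1 o1 /\ exchange o0 o1 o1 o1) <-> twist_exchange q^-1 d b.
Proof.
split=> [[E1 E2]|[E2 E1]].
  split=> i j.
    exchange_forward q (E2 (even_exponent i) (odd_exponent (j + 1))).
  exchange_forward (1 : F) (E1 (odd_exponent (j + 1)) (even_exponent i)).
split.
  exchange_backward (1 : F) E1.
exchange_backward q^-1 E2.
Qed.

Lemma exchange_dc : (exchange o1 o1 o1 o0 /\ exchange o1 o1 o0 o1) <-> twist_exchange q d c.
Proof.
split=> [[E1 E2]|[E1 E2]].
  split=> i j.
    exchange_forward (1 : F) (E1 (odd_exponent (j + 1)) (even_exponent i)).
  exchange_forward q (E2 (even_exponent i) (odd_exponent (j + 1))).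
split.
  exchange_backward (1 : F) E1.
exchange_backward q^-1 E2.
Qed.

Lemma exchange_diag : (exchange o0 o1 o0 o1 /\ exchange o1 o0 o1 o0) <->
  diagonal_exchange q a b c d.
Proof.
split=> [[E1 E2]|[E1 E2]].
  split=> i j.
    exchange_forward q (E1 (even_exponent j) (even_exponent i)).
  exchange_forward q (E2 (even_exponent j) (even_exponent i)).
split.
  exchange_backward q^-1 E1.
exchange_backward q^-1 E2.
Qed.

Lemma exchange_offdiag : (exchange o0 o1 o1 o0 /\ exchange o1 o0 o0 o1) <->
  offdiagonal_exchange q a b c d.
Proof.
split=> [[E1 E2]|[E1 E2]].
  split=> i j.
    exchange_forward (1 : F) (E1 (odd_exponent (j + 1)) (odd_exponent (i + 1))).
  exchange_forward (1 : F) (E2 (odd_exponent (j + 1)) (odd_exponent (i + 1))).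
split.
  exchange_backward (1 : F) E1.
exchange_backward (1 : F) E2.
Qed.

(** The sixteen entries split into four corners, four twisted pairs and the two pairs of the central
    block. *)
Lemma exchange_systemP :
  (forall i j i' j' : 'I_2, exchange i j i' j') <-> fm_system q a b c d.
Proof.
split=> [E|[aa bb cc dd ab ac db dc dg odg] i j i' j'].
  split.
  - exact/exchange_aa.
  - exact/exchange_bb.
  - exact/exchange_cc.
  - exact/exchange_dd.
  - by apply/exchange_ab; split.
  - by apply/exchange_ac; split.
  - by apply/exchange_db; split.
  - by apply/exchange_dc; split.
  - by apply/exchange_diag; split.
  - by apply/exchange_offdiag; split.
have [ab1 ab2] := exchange_ab.2 ab; have [ac1 ac2] := exchange_ac.2 ac.
have [db1 db2] := exchange_db.2 db; have [dc1 dc2] := exchange_dc.2 dc.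
have [dg1 dg2] := exchange_diag.2 dg; have [odg1 odg2] := exchange_offdiag.2 odg.
have aa1 := exchange_aa.2 aa; have bb1 := exchange_bb.2 bb.
have cc1 := exchange_cc.2 cc; have dd1 := exchange_dd.2 dd.
by case: (ord2_cases i) (ord2_cases j) (ord2_cases i') (ord2_cases j') => -> [] -> [] -> [] ->.
Qed.

End ExchangeCoefficients.

Section ExchangeMorphism.
Variables (F : fieldType) (A B : algType F) (phi : {lrmorphism A -> B}) (q : F).
Variable k : 'I_2 -> 'I_2 -> int -> A.

Let phiE := (fun c x => linearZ_LR phi c x : phi (c *: x) = c *: phi x,
  fun x y => raddfD phi x y : phi (x + y) = phi x + phi y,
  fun x => raddfN phi x : phi (- x) = - phi x,
  fun x y => rmorphM phi x y : phi (x * y) = phi x * phi y).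

Lemma exchange_left_morph i j i' j' n m :
  phi (exchange_left q k i j i' j' n m) =
  exchange_left q (fun i j n => phi (k i j n)) i j i' j' n m.
Proof.
by rewrite /exchange_left /exchange_left_term; case: (i == j); rewrite !phiE.
Qed.

Lemma exchange_right_morph i j i' j' n m :
  phi (exchange_right q k i j i' j' n m) =
  exchange_right q (fun i j n => phi (k i j n)) i j i' j' n m.
Proof.
by rewrite /exchange_right /exchange_right_term; case: (i' == j'); rewrite !phiE.
Qed.

End ExchangeMorphism.

(** * Coefficient sequences of the generating series *)

Section WeightedSequences.
Variables (F : fieldType) (A : algType F) (t : F).
Implicit Types (X Y : nat -> A) (al be ga de : F).

(** The generator of index k sits at k + 1, with weight t^(k+1), because U^(-k-1) is t^(k+1)
    u^(-2(k+1)). *)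
Definition weighted_seq X (i : int) : A :=
  if i is Posz k.+1 then t ^+ k.+1 *: X k else 0.

Definition affine_seq al ga X (i : int) : A :=
  al *: weighted_seq X i + (if i == 0 then ga%:A else 0).

Lemma affine_seq0 al ga X : affine_seq al ga X 0 = ga%:A.
Proof. by rewrite /affine_seq /= scaler0 add0r. Qed.

Lemma affine_seqS al ga X k : affine_seq al ga X k.+1 = (al * t ^+ k.+1) *: X k.
Proof. by rewrite /affine_seq /= addr0 scalerA. Qed.

Lemma affine_seq_lt0 al ga X (i : int) : i < 0 -> affine_seq al ga X i = 0.
Proof. by case: i => // k _; rewrite /affine_seq /= scaler0 addr0. Qed.

Lemma affine_seq_le0 al X (i : int) : i <= 0 -> affine_seq al 0 X i = 0.
Proof.
rewrite le_eqVlt => /orP[/eqP->|/affine_seq_lt0->//].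
by rewrite affine_seq0 scale0r.
Qed.

(** The constant terms are central and drop out of commutators. *)
Lemma commutator_affine al ga be de X Y i j :
  commutator (affine_seq al ga X i) (affine_seq be de Y j) =
  (al * be) *: commutator (weighted_seq X i) (weighted_seq Y j).
Proof.
rewrite /affine_seq; case: (i == 0); case: (j == 0); rewrite /commutator;
  nc_solve F A ltac:(ring).
Qed.

Lemma commutator_weightedS X Y (k l : nat) :
  commutator (weighted_seq X k.+1) (weighted_seq Y l.+1) =
  (t ^+ k.+1 * t ^+ l.+1) *: commutator (X k) (Y l).
Proof. by rewrite /commutator /=; nc_solve F A ltac:(ring). Qed.

Lemma commutator_weighted_le0 X Y (i j : int) : (i <= 0) || (j <= 0) ->
  commutator (weighted_seq X i) (weighted_seq Y j) = 0.
Proof.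
rewrite /commutator; case: i j => [[|k]|k] [[|l]|l]//= _;
  by rewrite ?(mul0r, mulr0) subrr.
Qed.

Hypothesis t0 : t != 0.

Let weight0 k l : t ^+ k * t ^+ l != 0.
Proof. by rewrite mulf_neq0 ?expf_neq0. Qed.

Let pos_cases (i : int) : i <= 0 \/ exists k : nat, i = k.+1.
Proof. by case: i => [[|k]|k]; [left|right; exists k|left]. Qed.

Lemma affine_commute al ga X : al != 0 ->
  (forall i j : int, commutator (affine_seq al ga X i) (affine_seq al ga X j) = 0) <->
  (forall k l, commutator (X k) (X l) = 0).
Proof.
move=> al0; split=> [xx k l|XX i j].
  apply: (scalerI (mulf_neq0 (mulf_neq0 al0 al0) (weight0 k.+1 l.+1))).
  by rewrite scaler0 -scalerA -commutator_weightedS -(commutator_affine _ ga _ ga) xx.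
rewrite commutator_affine.
have [i0|[k ->]] := pos_cases i; first by rewrite commutator_weighted_le0 ?i0// scaler0.
have [j0|[l ->]] := pos_cases j.
  by rewrite commutator_weighted_le0 ?j0 ?orbT// scaler0.
by rewrite commutator_weightedS XX !scaler0.
Qed.

Lemma affine_symmetric al ga be de X Y : al != 0 -> be != 0 ->
  symmetric_on (fun i j : int => commutator (affine_seq al ga X i) (affine_seq be de Y j)) <->
  (forall k l, commutator (X k) (Y l) = commutator (X l) (Y k)).
Proof.
move=> al0 be0; split=> [xy k l|XY i j].
  apply: (scalerI (mulf_neq0 (mulf_neq0 al0 be0) (weight0 k.+1 l.+1))).
  rewrite -[LHS]scalerA -commutator_weightedS -(commutator_affine _ ga _ de) xy.
  by rewrite commutator_affine commutator_weightedS scalerA (mulrC (t ^+ l.+1)).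
rewrite !commutator_affine.
have [i0|[k ->]] := pos_cases i.
  by rewrite !commutator_weighted_le0 ?i0 ?orbT.
have [j0|[l ->]] := pos_cases j.
  by rewrite !commutator_weighted_le0 ?j0 ?orbT.
by rewrite !commutator_weightedS XY (mulrC (t ^+ l.+1)).
Qed.

Let succS (k : nat) : (k.+1%:Z + 1)%R = k.+2%:Z.
Proof. by lia. Qed.

(** For j = k + 1 both sides carry t^(k+2), which cancels and leaves the quotient de / be. For j = 0
    the second sequence has the scalar value de and the identity holds for all X and Y; for j < 0
    both sides are 0. *)
Lemma affine_recursion al be de q X Y : al != 0 -> be != 0 ->
  (forall j : int, qcommutator q (affine_seq al 0 X 1) (affine_seq be de Y j) =
     ((q - q^-1) * de) *: affine_seq al 0 X (j + 1)) <->
  (forall k, qcommutator q (X 0%N) (Y k) = ((q - q^-1) * de / be) *: X k.+1).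
Proof.
move=> al0 be0.
have E k : qcommutator q (affine_seq al 0 X 1) (affine_seq be de Y k.+1) =
    (al * be * (t * t ^+ k.+1)) *: qcommutator q (X 0%N) (Y k).
  by rewrite !affine_seqS /qcommutator; nc_solve F A ltac:(ring).
split=> [xy k|XY].
  apply: (scalerI (mulf_neq0 (mulf_neq0 al0 be0) (weight0 1 k.+1))).
  rewrite -E xy succS affine_seqS !scalerA; congr (_ *: _).
  by rewrite !exprS; move: (q - q^-1) => s; field.
case=> [[|k]|k].
- rewrite affine_seq0 add0r affine_seqS /qcommutator; nc_solve F A ltac:(ring).
- rewrite E XY succS affine_seqS !scalerA; congr (_ *: _).
  by rewrite !exprS; move: (q - q^-1) => s; field.
- rewrite (@affine_seq_lt0 _ _ Y)// (@affine_seq_le0 _ _ (_ + 1)) ?scaler0; last by lia.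
  by rewrite /qcommutator mulr0 mul0r ?scaler0 subrr.
Qed.

End WeightedSequences.

Section WeightedSequenceMorphism.
Variables (F : fieldType) (A B : algType F) (phi : {lrmorphism A -> B}).

Lemma affine_seq_morph t al ga (X : nat -> A) i :
  phi (affine_seq t al ga X i) = affine_seq t al ga (fun k => phi (X k)) i.
Proof.
rewrite /affine_seq linearD /= linearZ; congr (_ *: _ + _).
  by case: i => [[|k]|k]; rewrite /= ?raddf0// linearZ.
by case: (i == 0); rewrite ?raddf0// linearZ rmorph1.
Qed.

End WeightedSequenceMorphism.

(** * The alternating relations as relations between the coefficients of K *)

Section AlternatingRelations.
Variables (F : fieldType) (A : algType F) (q kp km : F) (Wn Wp G Gt : nat -> A).

(** Stated for four sequences in any algebra, so that the images of the generators under a morphism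
    can be substituted. *)
Record alternating_relations (rho : F) : Prop := AlternatingRelations {
  rel_W0Wp : forall k, commutator (Wn 0%N) (Wp k) = commutator (Wn k) (Wp 0%N);
  rel_WnW1 : forall k, commutator (Wn k) (Wp 0%N) = (q + q^-1)^-1 *: (Gt k - G k);
  rel_W0G : forall k, qcommutator q (Wn 0%N) (G k) = qcommutator q (Gt k) (Wn 0%N);
  rel_GtW0 : forall k, qcommutator q (Gt k) (Wn 0%N) = rho *: Wn k.+1;
  rel_GW1 : forall k, qcommutator q (G k) (Wp 0%N) = qcommutator q (Wp 0%N) (Gt k);
  rel_W1Gt : forall k, qcommutator q (Wp 0%N) (Gt k) = rho *: Wp k.+1;
  rel_WnWn : forall k l, commutator (Wn k) (Wn l) = 0;
  rel_WpWp : forall k l, commutator (Wp k) (Wp l) = 0;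
  rel_WnWp : forall k l, commutator (Wn k) (Wp l) + commutator (Wp k) (Wn l) = 0;
  rel_WnG : forall k l, commutator (Wn k) (G l) + commutator (G k) (Wn l) = 0;
  rel_WnGt : forall k l, commutator (Wn k) (Gt l) + commutator (Gt k) (Wn l) = 0;
  rel_WpG : forall k l, commutator (Wp k) (G l) + commutator (G k) (Wp l) = 0;
  rel_WpGt : forall k l, commutator (Wp k) (Gt l) + commutator (Gt k) (Wp l) = 0;
  rel_GG : forall k l, commutator (G k) (G l) = 0;
  rel_GtGt : forall k l, commutator (Gt k) (Gt l) = 0;
  rel_GtG : forall k l, commutator (Gt k) (G l) + commutator (G k) (Gt l) = 0 }.

(* U^-1 = Uscale u^(-2) *)
Definition Uscale : F := (q + q^-1) / q.

Definition coef_a := affine_seq Uscale q 0 Wn.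
Definition coef_d := affine_seq Uscale q 0 Wp.
Definition coef_b :=
  affine_seq Uscale (km * (q + q^-1))^-1 (kp * (q + q^-1) / (q - q^-1)) G.
Definition coef_c :=
  affine_seq Uscale (kp * (q + q^-1))^-1 (km * (q + q^-1) / (q - q^-1)) Gt.

Hypotheses (q0 : q != 0) (e0 : q - q^-1 != 0) (s0 : q + q^-1 != 0).
Hypotheses (kp0 : kp != 0) (km0 : km != 0).

Let t0 : Uscale != 0. Proof. by rewrite mulf_neq0 ?invr_eq0. Qed.

Local Notation be := (kp * (q + q^-1) / (q - q^-1)).
Local Notation ch := (km * (q + q^-1) / (q - q^-1)).

Let al_b0 : (km * (q + q^-1))^-1 != 0. Proof. by rewrite invr_eq0 mulf_neq0. Qed.
Let al_c0 : (kp * (q + q^-1))^-1 != 0. Proof. by rewrite invr_eq0 mulf_neq0. Qed.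

Let sum_commutator (x y z w : A) :
  commutator x y + commutator z w = 0 <-> commutator x y = commutator w z.
Proof.
rewrite -[commutator z w]opprK; split=> [/eqP|->]; last first.
  by rewrite /commutator opprB subrr.
by rewrite subr_eq0 => /eqP->; rewrite /commutator opprB.
Qed.

Let lamE : (q - q^-1) * be = kp * (q + q^-1). Proof. by rewrite mulrC divfK. Qed.
Let muE : (q - q^-1) * ch = km * (q + q^-1). Proof. by rewrite mulrC divfK. Qed.

(** The constant terms of K are such that lam and mu cancel the scalars 1/(k_+ (q + q^-1)) and
    1/(k_- (q + q^-1)) before the series of [Gt] and [G]. *)
Let diag_rhs k : q *: (((q - q^-1) * be) *: coef_c k.+1 - ((q - q^-1) * ch) *: coef_b k.+1)
  = (q * Uscale ^+ k.+1) *: (Gt k - G k).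
Proof.
rewrite lamE muE /coef_b /coef_c !affine_seqS.
have := s0; move: (q + q^-1) Uscale => s t s1.
by nc_solve F A ltac:(field; rewrite ?kp0 ?km0 ?s1 //).
Qed.

(** The normalisation of U enters here: q [Uscale] is q + q^-1, the denominator in the relation for
    [W_0, W_(k+1)]. *)
Let diag_prefix (x y : A) k :
  (q * (q * (Uscale ^+ 1 * Uscale ^+ k.+1))) *: x = (q * Uscale ^+ k.+1) *: y <->
  x = (q + q^-1)^-1 *: y.
Proof.
have E : q * (q * (Uscale ^+ 1 * Uscale ^+ k.+1)) = (q * Uscale ^+ k.+1) * (q + q^-1).
  by rewrite /Uscale; move: (q + q^-1) (_ ^+ k.+1) => s w; field.
have c0 : q * Uscale ^+ k.+1 != 0 by rewrite mulf_neq0 ?expf_neq0.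
rewrite E; split=> [/eqP|->]; last by rewrite scalerA -mulrA mulfV ?mulr1.
rewrite -scalerA => /eqP/(scalerI c0)<-.
by rewrite scalerA mulVf ?scale1r.
Qed.

Let diag_rhs_le0 (j : int) : j <= 0 ->
  q *: (((q - q^-1) * be) *: coef_c j - ((q - q^-1) * ch) *: coef_b j) = 0.
Proof.
rewrite /coef_b /coef_c le_eqVlt => /orP[/eqP->|j0].
  by rewrite !affine_seq0; nc_solve F A ltac:(ring).
by rewrite !affine_seq_lt0// !scaler0 subrr scaler0.
Qed.

Let pos_cases (i : int) : i <= 0 \/ exists k : nat, i = k.+1.
Proof. by case: i => [[|k]|k]; [left|right; exists k|left]. Qed.

Let commutator_ad (k l : nat) : commutator (coef_a k.+1) (coef_d l.+1) =
  (q * (q * (Uscale ^+ k.+1 * Uscale ^+ l.+1))) *: commutator (Wn k) (Wp l).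
Proof.
by rewrite /coef_a /coef_d commutator_affine commutator_weightedS scalerA -!mulrA.
Qed.

Let diag_a1P :
  (forall j : int, commutator (coef_a 1) (coef_d j) =
     q *: (((q - q^-1) * be) *: coef_c j - ((q - q^-1) * ch) *: coef_b j)) <->
  (forall k, commutator (Wn 0%N) (Wp k) = (q + q^-1)^-1 *: (Gt k - G k)).
Proof.
split=> [ad k|wp j].
  by apply/(@diag_prefix _ _ k); rewrite -diag_rhs -ad commutator_ad.
have [j0|[k ->]] := pos_cases j; last by rewrite diag_rhs commutator_ad; apply/(@diag_prefix _ _ k).
rewrite diag_rhs_le0// /coef_a /coef_d commutator_affine.
by rewrite commutator_weighted_le0 ?j0 ?orbT// scaler0.
Qed.

Let diag_d1P :
  (forall j : int, commutator (coef_a j) (coef_d 1) =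
     q *: (((q - q^-1) * be) *: coef_c j - ((q - q^-1) * ch) *: coef_b j)) <->
  (forall k, commutator (Wn k) (Wp 0%N) = (q + q^-1)^-1 *: (Gt k - G k)).
Proof.
split=> [ad k|wp j].
  by apply/(@diag_prefix _ _ k); rewrite -diag_rhs -ad commutator_ad (mulrC (_ ^+ k.+1)).
have [j0|[k ->]] := pos_cases j.
  rewrite diag_rhs_le0// /coef_a /coef_d commutator_affine.
  by rewrite commutator_weighted_le0 ?j0// scaler0.
by rewrite diag_rhs commutator_ad (mulrC (_ ^+ k.+1)); apply/(@diag_prefix _ _ k).
Qed.

Let qcommutatorV (x y : A) : qcommutator q^-1 x y = - qcommutator q y x.
Proof. by rewrite /qcommutator invrK opprB. Qed.

(** The quotient de / be of [affine_recursion] produces the parameter rho = k_+ k_- (q + q^-1)^2.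
    For t = q^-1 it changes sign, and so does the q-commutator when its arguments are exchanged. *)
Let rec_up : (q - q^-1) * be / (km * (q + q^-1))^-1 = kp * km * (q + q^-1) ^+ 2.
Proof. by rewrite lamE invrK mulrACA -expr2.  Qed.

Let rec_up' : (q - q^-1) * ch / (kp * (q + q^-1))^-1 = kp * km * (q + q^-1) ^+ 2.
Proof. by rewrite muE invrK mulrACA -expr2 (mulrC km). Qed.

Let rec_down : (q^-1 - q^-1^-1) * be / (km * (q + q^-1))^-1 =
  - (kp * km * (q + q^-1) ^+ 2).
Proof. by rewrite invrK -opprB !mulNr rec_up. Qed.

Let rec_down' : (q^-1 - q^-1^-1) * ch / (kp * (q + q^-1))^-1 =
  - (kp * km * (q + q^-1) ^+ 2).
Proof. by rewrite invrK -opprB !mulNr rec_up'. Qed.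

(** The twist recursions are the q-commutators of W_0 or W_1 with [G] or [Gt], the symmetries are
    the sums of two commutators, and [alt_a1] and [alt_d1] are [W_0, W_(k+1)] and [W_(-k), W_1].
    Chained equalities are recovered by comparing both members with their common value. *)
Lemma alternating_relationsP :
  alternating_relations (kp * km * (q + q^-1) ^+ 2) <->
  alt_system q be ch coef_a coef_b coef_c coef_d.
Proof.
split=> [rel|alt].
- split.
  + exact/affine_commute/(rel_WnWn rel).
  + exact/affine_commute/(rel_GG rel).
  + exact/affine_commute/(rel_GtGt rel).
  + exact/affine_commute/(rel_WpWp rel).
  + split.
      by apply/affine_recursion => // k; rewrite rec_up (rel_W0G rel) (rel_GtW0 rel).
    by apply/affine_symmetric => // k l; apply/sum_commutator/(rel_WnG rel).
  + split.
      apply/affine_recursion => // k.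
      by rewrite rec_down' qcommutatorV (rel_GtW0 rel) scaleNr.
    by apply/affine_symmetric => // k l; apply/sum_commutator/(rel_WnGt rel).
  + split.
      apply/affine_recursion => // k.
      by rewrite rec_down qcommutatorV (rel_GW1 rel) (rel_W1Gt rel) scaleNr.
    by apply/affine_symmetric => // k l; apply/sum_commutator/(rel_WpG rel).
  + split.
      by apply/affine_recursion => // k; rewrite rec_up' (rel_W1Gt rel).
    by apply/affine_symmetric => // k l; apply/sum_commutator/(rel_WpGt rel).
  + by apply/affine_symmetric => // k l; apply/sum_commutator/(rel_WnWp rel).
  + apply/affine_symmetric => // k l; apply/esym/sum_commutator.
    by rewrite addrC (rel_GtG rel).
  + by apply/diag_a1P => k; rewrite (rel_W0Wp rel) (rel_WnW1 rel).
  + exact/diag_d1P/(rel_WnW1 rel).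
- have [ab1 /affine_symmetric ab2] := alt_ab alt.
  have [ac1 /affine_symmetric ac2] := alt_ac alt.
  have [db1 /affine_symmetric db2] := alt_db alt.
  have [dc1 /affine_symmetric dc2] := alt_dc alt.
  have W0G := (affine_recursion t0 _ _ _ _ q0 al_b0).1 ab1.
  have W0Gt := (affine_recursion t0 _ _ _ _ q0 al_c0).1 ac1.
  have W1G := (affine_recursion t0 _ _ _ _ q0 al_b0).1 db1.
  have W1Gt := (affine_recursion t0 _ _ _ _ q0 al_c0).1 dc1.
  have WnW1 := diag_d1P.1 (alt_d1 alt).
  have W0Wp := diag_a1P.1 (alt_a1 alt).
  have GtW0 k : qcommutator q (Gt k) (Wn 0%N) = (kp * km * (q + q^-1) ^+ 2) *: Wn k.+1.
    by rewrite -[LHS]opprK -qcommutatorV W0Gt rec_down' scaleNr opprK.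
  have GW1 k : qcommutator q (G k) (Wp 0%N) = (kp * km * (q + q^-1) ^+ 2) *: Wp k.+1.
    by rewrite -[LHS]opprK -qcommutatorV W1G rec_down scaleNr opprK.
  split=> [k|k|k|k|k|k|k l|k l|k l|k l|k l|k l|k l|k l|k l|k l].
  + by rewrite W0Wp WnW1.
  + exact: WnW1.
  + by rewrite W0G rec_up GtW0.
  + exact: GtW0.
  + by rewrite GW1 W1Gt rec_up'.
  + by rewrite W1Gt rec_up'.
  + exact: (affine_commute t0 _ _ q0).1 (alt_aa alt) k l.
  + exact: (affine_commute t0 _ _ q0).1 (alt_dd alt) k l.
  + by apply/sum_commutator; apply: (affine_symmetric t0 _ _ _ _ q0 q0).1 (alt_ad alt) k l.
  + by apply/sum_commutator; apply: ab2.
  + by apply/sum_commutator; apply: ac2.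
  + by apply/sum_commutator; apply: db2.
  + by apply/sum_commutator; apply: dc2.
  + exact: (affine_commute t0 _ _ al_b0).1 (alt_bb alt) k l.
  + exact: (affine_commute t0 _ _ al_c0).1 (alt_cc alt) k l.
  + rewrite addrC; apply/sum_commutator.
    exact: (affine_symmetric t0 _ _ _ _ al_b0 al_c0).1 (alt_bc alt) k l.
Qed.

Lemma fm_system_alternatingP :
  fm_system q coef_a coef_b coef_c coef_d <->
  alternating_relations (kp * km * (q + q^-1) ^+ 2).
Proof.
have be0 : be != 0 by rewrite !mulf_neq0 ?invr_eq0.
have ch0 : ch != 0 by rewrite !mulf_neq0 ?invr_eq0.
apply: iff_trans _ (iff_sym alternating_relationsP).
apply: fm_systemP => // [i|i|i|i||].
- exact: affine_seq_le0.
- exact: affine_seq_le0.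
- exact: affine_seq_lt0.
- exact: affine_seq_lt0.
- exact: affine_seq0.
- exact: affine_seq0.
Qed.

End AlternatingRelations.

(** * Entries of the two matrix products over a noncommutative ring *)

Section ExchangeMatrices.
Variable L : nzRingType.
Implicit Types (P Q : 'M[L]_2) (M : 'M[L]_(2 * 2)).

Local Notation "i '# j" := (mxtens_index (i, j)) (at level 20).

Lemma sum_mxtens (f : 'I_(2 * 2) -> L) :
  \sum_k f k = \sum_(i < 2) \sum_(j < 2) f (i '# j).
Proof.
rewrite pair_big (reindex (@mxtens_index 2 2)); last first.
  by exists (@mxtens_unindex 2 2) => k _; rewrite ?mxtens_indexK ?mxtens_unindexK.
by apply: eq_big => // -[].
Qed.

Lemma mulmx_tensr1 M P i j k l :
  (M *m (P *t (1%:M : 'M_2))) (i '# j) (k '# l) = \sum_i' M (i '# j) (i' '# l) * P i' k.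
Proof.
rewrite mxE sum_mxtens; apply: eq_bigr => i' _; rewrite (bigD1 l)//= big1 => [|j' jl].
  by rewrite tensmxE mxE eqxx mulr1 addr0.
by rewrite tensmxE mxE (negPf jl) !mulr0.
Qed.

Lemma mulmx_tens1r M Q i j k l :
  (M *m ((1%:M : 'M_2) *t Q)) (i '# j) (k '# l) = \sum_j' M (i '# j) (k '# j') * Q j' l.
Proof.
rewrite mxE sum_mxtens (bigD1 k)//= [X in _ + X]big1 => [|i' ik].
  by rewrite addr0; apply: eq_bigr => j' _; rewrite tensmxE mxE eqxx mul1r.
by rewrite big1// => j' _; rewrite tensmxE mxE (negPf ik) mul0r mulr0.
Qed.

Variables x y e r : L.

Definition six_vertex_mx : 'M[L]_(2 * 2) := rows_mx (2 * 2)
  [:: [:: x; 0; 0; 0]; [:: 0; y; e; 0]; [:: 0; e; y; 0]; [:: 0; 0; 0; x]].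

Definition twist_mx : 'M[L]_(2 * 2) := rows_mx (2 * 2)
  [:: [:: 1; 0; 0; 0]; [:: 0; r; 0; 0]; [:: 0; 0; r; 0]; [:: 0; 0; 0; 1]].

Definition twist_entry (i j : 'I_2) : L := if i == j then 1 else r.

Lemma six_vertex_mxE i j k l : six_vertex_mx (i '# j) (k '# l) =
  if i == j then if (k == i) && (l == i) then x else 0
  else if k == l then 0 else if k == i then y else e.
Proof.
by rewrite mxE; case: i j k l => [[|[|]]//= ?] [[|[|]]//= ?] [[|[|]]//= ?] [[|[|]]//= ?].
Qed.

Lemma twist_mxE i j k l : twist_mx (i '# j) (k '# l) =
  if (k == i) && (l == j) then twist_entry i j else 0.
Proof.
by rewrite mxE; case: i j k l => [[|[|]]//= ?] [[|[|]]//= ?] [[|[|]]//= ?] [[|[|]]//= ?].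
Qed.

Lemma mulmx_twist M i j k l :
  (M *m twist_mx) (i '# j) (k '# l) = M (i '# j) (k '# l) * twist_entry k l.
Proof.
rewrite mxE sum_mxtens (bigD1 k)//= (bigD1 l)//= twist_mxE !eqxx /=.
rewrite big1 => [|l' /negPf ll]; last by rewrite twist_mxE (eq_sym l) ll andbF mulr0.
rewrite big1 ?addr0// => k' /negPf kk; apply: big1 => l' _.
by rewrite twist_mxE (eq_sym k) kk mulr0.
Qed.

Definition lhs_term P Q (i j k l : 'I_2) : L := P i k * twist_entry k j * Q j l.
Definition rhs_term P Q (i j k l : 'I_2) : L := Q j l * twist_entry i l * P i k.

(** The factor K(u) acts on the first tensor index, K(v) on the second, and R^(0) is diagonal; each
    entry of their product is thus a single product, and R adds the term with i and j swapped. *)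
Lemma exchange_lhsE P Q i j k l :
  (six_vertex_mx *m (P *t 1%:M) *m twist_mx *m (1%:M *t Q)) (i '# j) (k '# l) =
  if i == j then x * lhs_term P Q i j k l
  else y * lhs_term P Q i j k l + e * lhs_term P Q j i k l.
Proof.
rewrite mulmx_tens1r !big_ord_recl big_ord0 !mulmx_twist !mulmx_tensr1.
rewrite !big_ord_recl !big_ord0 !six_vertex_mxE /lhs_term !addr0.
case: (ord2_cases i) => ->; case: (ord2_cases j) => -> /=.
all: by rewrite !(mul0r, addr0, add0r) !mulrA // addrC.
Qed.

Lemma exchange_rhsE P Q i j k l :
  ((1%:M *t Q) *m twist_mx *m (P *t 1%:M) *m six_vertex_mx) (i '# j) (k '# l) =
  if k == l then rhs_term P Q i j k l * x
  else rhs_term P Q i j k l * y + rhs_term P Q i j l k * e.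
Proof.
have E i' j' k' l' : ((1%:M *t Q) *m twist_mx *m (P *t 1%:M)) (i' '# j') (k' '# l') =
    rhs_term P Q i' j' k' l'.
  rewrite mulmx_tensr1 (bigD1 i')//= mulmx_twist tensmxE mxE eqxx mul1r.
  rewrite big1 ?addr0// => m im.
  by rewrite mulmx_twist tensmxE mxE eq_sym (negPf im) !mul0r.
rewrite mxE sum_mxtens !big_ord_recl !big_ord0 !E !six_vertex_mxE !addr0.
case: (ord2_cases k) => ->; case: (ord2_cases l) => -> /=.
all: by rewrite !(mulr0, addr0, add0r) // addrC.
Qed.
End ExchangeMatrices.

(** * Coefficients of Laurent series in two variables *)

Section LaurentCoefficients.
Variables (A : nzRingType).
Implicit Types (f : laurent (laurent A)) (s r : laurent A).

Lemma lcoef2_monol i j (x : A) f n m :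
  (lmono j (lmono i x) * f) n m = x * f (n - j) (m - i).
Proof. by rewrite lcoef_monol lcoef_monol. Qed.

Lemma lcoef2_monor i j (x : A) f n m :
  (f * lmono j (lmono i x)) n m = f (n - j) (m - i) * x.
Proof. by rewrite lcoef_monor lcoef_monor. Qed.

Lemma in_uME s f n : (in_u s * f) n = s * f n.
Proof. by rewrite -[n in RHS]subr0; exact: lcoef_monol. Qed.

Lemma mul_in_uE s f n : (f * in_u s) n = f n * s.
Proof. by rewrite -[n in RHS]subr0; exact: lcoef_monor. Qed.

Lemma in_uM_monomial i j :
  in_u (lmono i 1) * in_v (lmono j 1) = lmono j (lmono i (1 : A)).
Proof.
apply: laurentP => n; apply: laurentP => m.
rewrite in_uME lcoef_monol mul1r /=; case: (n == j) => /=; last by case: ifP.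
by rewrite subr_eq0.
Qed.

(** Each variable occurs in one factor only, so no Cauchy sum remains. *)
Lemma lcoef_in_uv s (x : A) r n m :
  (in_u s * lmono 0 (lmono 0 x) * in_v r) n m = s m * x * r n.
Proof.
transitivity ((in_u s * (lmono 0 (lmono 0 x) * in_v r)) n m).
  exact: (congr1 (fun h : laurent (laurent A) => h n m) (esym (mulrA _ _ _))).
transitivity ((s * (lmono 0 (x * r n))) m); last first.
  by rewrite lcoef_monor subr0 mulrA.
rewrite in_uME; congr ((s * _ : laurent A) m); apply: laurentP => p.
rewrite lcoef2_monol !subr0 /=.
by case: ifP => _ //; rewrite mulr0.
Qed.

Lemma lcoef_in_vu s (x : A) r n m :
  (in_v r * lmono 0 (lmono 0 x) * in_u s) n m = r n * x * s m.
Proof.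
rewrite mul_in_uE.
transitivity ((lmono 0 (r n * x) * s) m); last first.
  by rewrite lcoef_monol subr0.
congr ((_ * s : laurent A) m); apply: laurentP => p.
rewrite lcoef2_monor !subr0 /=.
by case: ifP => _ //; rewrite mul0r.
Qed.

End LaurentCoefficients.

Section LaurentAlgebraCoefficients.
Variables (F : fieldType) (A : algType F).
Implicit Types (f g : laurent (laurent A)) (c : F).

Lemma lcoef2B f g n m : (f - g) n m = f n m - g n m.
Proof. by []. Qed.

Lemma lcoef2D f g n m : (f + g) n m = f n m + g n m.
Proof. by []. Qed.

Lemma lcoef2Z c f n m : (c *: f) n m = c *: f n m.
Proof. by []. Qed.

Definition scalar2 c : laurent (laurent A) := lmono 0 (lmono 0 c%:A).

Lemma lmono2Z c i j :
  c *: lmono j (lmono i 1) = lmono j (lmono i (c%:A : A)).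
Proof.
apply: laurentP => n; apply: laurentP => m.
rewrite lcoef2Z /=; case: (n == j) => /=; last by rewrite scaler0.
by case: (m == i); rewrite ?scaler0.
Qed.

Lemma scalar2E c : c%:A = scalar2 c.
Proof. exact: lmono2Z. Qed.

(* c u/v - c^(-1) v/u, with outer indeterminate v *)
Definition weight c : laurent (laurent A) :=
  lmono (-1) (lmono 1 c%:A) - lmono 1 (lmono (-1) c^-1%:A).

Lemma lcoef_weightl c f n m :
  (weight c * f) n m = c *: f (n + 1) (m - 1) - c^-1 *: f (n - 1) (m + 1).
Proof.
transitivity ((lmono (-1) (lmono 1 c%:A) * f - lmono 1 (lmono (-1) c^-1%:A) * f) n m).
  exact: (congr1 (fun h : laurent (laurent A) => h n m) (mulrBl _ _ _)).
by rewrite lcoef2B !lcoef2_monol !opprK -!scalerAl !mul1r.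
Qed.

Lemma lcoef_weightr c f n m :
  (f * weight c) n m = c *: f (n + 1) (m - 1) - c^-1 *: f (n - 1) (m + 1).
Proof.
transitivity ((f * lmono (-1) (lmono 1 c%:A) - f * lmono 1 (lmono (-1) c^-1%:A)) n m).
  exact: (congr1 (fun h : laurent (laurent A) => h n m) (mulrBr _ _ _)).
by rewrite lcoef2B !lcoef2_monor !opprK -!scalerAr !mulr1.
Qed.

Lemma lcoef_scalar2l c f n m : (scalar2 c * f) n m = c *: f n m.
Proof. by rewrite lcoef2_monol !subr0 -scalerAl mul1r. Qed.

Lemma lcoef_scalar2r c f n m : (f * scalar2 c) n m = c *: f n m.
Proof. by rewrite lcoef2_monor !subr0 -scalerAr mulr1. Qed.

Lemma lcoef_weight_scalar2l c c' f f' n m :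
  (weight c * f + scalar2 c' * f') n m =
  c *: f (n + 1) (m - 1) - c^-1 *: f (n - 1) (m + 1) + c' *: f' n m.
Proof. by rewrite lcoef2D lcoef_weightl lcoef_scalar2l. Qed.

Lemma lcoef_weight_scalar2r c c' f f' n m :
  (f * weight c + f' * scalar2 c') n m =
  c *: f (n + 1) (m - 1) - c^-1 *: f (n - 1) (m + 1) + c' *: f' n m.
Proof. by rewrite lcoef2D lcoef_weightr lcoef_scalar2r. Qed.

Lemma weightE c :
  c *: (in_u (lmono 1 1) * in_v (lmono (-1) 1)) -
  c^-1 *: (in_u (lmono (-1) 1) * in_v (lmono 1 1)) = weight c.
Proof. by rewrite !in_uM_monomial !lmono2Z. Qed.

Lemma weight1E :
  in_u (lmono 1 1) * in_v (lmono (-1) 1) -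
  in_u (lmono (-1) 1) * in_v (lmono 1 1) = weight 1.
Proof. by rewrite !in_uM_monomial /weight invr1 !scale1r. Qed.

End LaurentAlgebraCoefficients.

(** * Coefficients of the Freidel-Maillet equation *)

Section FMEntries.
Variables (K : fieldType) (A : algType {fraction {poly K}}) (g : alt_gen -> A).
Variables kp km : {fraction {poly K}}.

Local Notation q := (qvar K).
Local Notation L2 := (laurent (laurent A)).
Local Notation "i '# j" := (mxtens_index (i, j)) (at level 20).
Local Notation Kuv := (Kmx g kp km).

Local Notation w := (in_u (lmono 1 1) * in_v (lmono (-1) 1) : L2).
Local Notation winv := (in_u (lmono (-1) 1) * in_v (lmono 1 1) : L2).

Lemma R_uvE : R_uv A =
  six_vertex_mx (weight A q) (weight A 1) (scalar2 A (q - q^-1)).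
Proof.
have weight_q : q *: w - q^-1 *: winv = weight A q; first exact (weightE A q).
have weight_1 : w - winv = weight A 1; first exact (weight1E A).
have scalar_e : (q - q^-1)%:A = scalar2 A (q - q^-1); first exact (scalar2E A _).
transitivity (six_vertex_mx (q *: w - q^-1 *: winv) (w - winv) ((q - q^-1)%:A)).
  by unfold R_uv, Rmx, six_vertex_mx; reflexivity.
exact (f_equal3 (@six_vertex_mx L2) weight_q weight_1 scalar_e).
Qed.

Lemma R0mxE : R0mx A = twist_mx (scalar2 A q^-1).
Proof.
have E : R0mx A = twist_mx (q^-1%:A) by unfold R0mx, twist_mx; reflexivity.
refine (eq_trans E _).
refine (f_equal (@twist_mx L2) _).
refine (scalar2E A _).
Qed.

Lemma twist_entry_scalar i j :
  twist_entry (scalar2 A q^-1) i j = scalar2 A (twist_weight q i j).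
Proof.
rewrite /twist_entry /twist_weight; case: eqP => // _.
rewrite -[RHS]scalar2E; exact (esym (scale1r _)).
Qed.

Local Notation kuv := (fun i j : 'I_2 => lcoef (Kuv i j)).

Let lhs_termE i j k l n m :
  lhs_term (scalar2 A q^-1) (K_u g kp km) (K_v g kp km) i j k l n m =
  exchange_left_term q kuv i j k l n m.
Proof.
rewrite /lhs_term twist_entry_scalar /K_u /K_v /exchange_left_term.
move: Kuv => P.
by rewrite !mxE lcoef_in_uv -scalerAr -scalerAl mulr1.
Qed.

Let rhs_termE i j k l n m :
  rhs_term (scalar2 A q^-1) (K_u g kp km) (K_v g kp km) i j k l n m =
  exchange_right_term q kuv i j k l n m.
Proof.
rewrite /rhs_term twist_entry_scalar /K_u /K_v /exchange_right_term.
move: Kuv => P.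
by rewrite !mxE lcoef_in_vu -scalerAr -scalerAl mulr1.
Qed.

Lemma FM_lhs_coef i j k l n m :
  FM_lhs g kp km (i '# j) (k '# l) n m = exchange_left q kuv i j k l n m.
Proof.
rewrite /FM_lhs R_uvE R0mxE exchange_lhsE /exchange_left; case: (i == j).
  by rewrite lcoef_weightl !lhs_termE.
rewrite lcoef_weight_scalar2l invr1 !scale1r.
by rewrite !lhs_termE.
Qed.

Lemma FM_rhs_coef i j k l n m :
  FM_rhs g kp km (i '# j) (k '# l) n m = exchange_right q kuv i j k l n m.
Proof.
rewrite /FM_rhs R_uvE R0mxE exchange_rhsE /exchange_right; case: (k == l).
  by rewrite lcoef_weightr !rhs_termE.
rewrite lcoef_weight_scalar2r invr1 !scale1r.
by rewrite !rhs_termE.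
Qed.

End FMEntries.

(** * Coefficients of the entries of K(u) *)

Section GeneratingSeries.
Variables (K : fieldType) (A : algType {fraction {poly K}}).

Local Notation Kq := {fraction {poly K}}.
Local Notation q := (qvar K).

Local Notation scale := (Uscale q).

(** Each power of U^-1 is a monomial, so every exponent receives at most one term of the series. *)
Let Useries_term (h : nat -> A) k n : (lmono 0 (h k) * Uinv A ^+ k.+1) n =
  if n == - (2 * k.+1)%N%:Z then scale ^+ k.+1 *: h k else 0.
Proof.
rewrite lcoef_monol subr0 UinvX /=; case: eqP => _; last by rewrite mulr0.
by rewrite -scalerAr mulr1.
Qed.

Lemma Useries_even h (i : int) : @Useries K A h (- (2 * i)) = weighted_seq scale h i.
Proof.
rewrite /= /Useries_fun; case: i => [[|k]|k]; last 2 first.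
- rewrite (fsbigE [:: k]) ?big_mkcond ?big_seq1 ?in_setT// => [|j _].
    by rewrite Useries_term eqxx.
  rewrite Useries_term; case: ifP => // /eqP E; rewrite inE => /eqP[].
  by move: j E => /= j E; lia.
- by rewrite fsbig1// => k' _; rewrite Useries_term; case: eqP => // jk; lia.
- by rewrite fsbig1// => k' _; rewrite Useries_term; case: eqP => // jk; lia.
Qed.

Lemma Useries_odd h (i : int) : @Useries K A h (1 - 2 * i) = 0.
Proof.
by rewrite /= /Useries_fun fsbig1// => k _; rewrite Useries_term; case: eqP => // ik; lia.
Qed.

Variables (g : alt_gen -> A) (kp km : Kq).

Local Notation a := (coef_a q (fun k => g (Wneg k))).
Local Notation d := (coef_d q (fun k => g (Wpos k))).
Local Notation b := (coef_b q kp km (fun k => g (Gplus k))).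
Local Notation c := (coef_c q kp km (fun k => g (Gtilde k))).
Local Notation Kuv := (Kmx g kp km).
Local Notation o0 := (ord0 : 'I_2).
Local Notation o1 := (lift ord0 (ord0 : 'I_1) : 'I_2).

Let mono_shift (s : laurent A) n : (lmono 1 1 * s) n = s (n - 1).
Proof. by rewrite lcoef_monol mul1r. Qed.

Let scalar_coef (c : Kq) n : (c%:A : laurent A) n = if n == 0 then c%:A else 0.
Proof. by rewrite lcoefZ /=; case: eqP; rewrite ?scaler0. Qed.

Lemma Kmx_a i : Kuv o0 o0 (1 - 2 * i) = a i.
Proof.
rewrite mxE /= -[LHS]/(q *: ((lmono 1 1 * Wplus_series g) (1 - 2 * i))).
(* The prefactor u moves the even exponent -2i of the series to 1 - 2i. *)
rewrite mono_shift addrAC subrr add0r Useries_even.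
by rewrite /coef_a /affine_seq scale0r if_same addr0.
Qed.

Lemma Kmx_a0 i : Kuv o0 o0 (- (2 * i)) = 0.
Proof.
rewrite mxE /= -[LHS]/(q *: ((lmono 1 1 * Wplus_series g) (- (2 * i)))).
rewrite mono_shift (_ : - (2 * i) - 1 = 1 - 2 * (i + 1)); last by ring.
by rewrite Useries_odd scaler0.
Qed.

Lemma Kmx_d i : Kuv o1 o1 (1 - 2 * i) = d i.
Proof.
rewrite mxE /= -[LHS]/(q *: ((lmono 1 1 * Wminus_series g) (1 - 2 * i))).
rewrite mono_shift addrAC subrr add0r Useries_even.
by rewrite /coef_d /affine_seq scale0r if_same addr0.
Qed.

Lemma Kmx_d0 i : Kuv o1 o1 (- (2 * i)) = 0.
Proof.
rewrite mxE /= -[LHS]/(q *: ((lmono 1 1 * Wminus_series g) (- (2 * i)))).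
rewrite mono_shift (_ : - (2 * i) - 1 = 1 - 2 * (i + 1)); last by ring.
by rewrite Useries_odd scaler0.
Qed.

Lemma Kmx_b i : Kuv o0 o1 (- (2 * i)) = b i.
Proof.
rewrite mxE /= -[LHS]/((km * (q + q^-1))^-1 *: (Gplus_series g (- (2 * i))) +
  (((kp * (q + q^-1) / (q - q^-1))%:A : laurent A) (- (2 * i)))).
rewrite Useries_even scalar_coef /coef_b /affine_seq; congr (_ + _).
by rewrite oppr_eq0 mulf_eq0.
Qed.

Lemma Kmx_b0 i : Kuv o0 o1 (1 - 2 * i) = 0.
Proof.
rewrite mxE /= -[LHS]/((km * (q + q^-1))^-1 *: (Gplus_series g (1 - 2 * i)) +
  (((kp * (q + q^-1) / (q - q^-1))%:A : laurent A) (1 - 2 * i))).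
rewrite Useries_odd scalar_coef scaler0 add0r.
by case: eqP => // ?; lia.
Qed.

Lemma Kmx_c i : Kuv o1 o0 (- (2 * i)) = c i.
Proof.
rewrite mxE /= -[LHS]/((kp * (q + q^-1))^-1 *: (Gminus_series g (- (2 * i))) +
  (((km * (q + q^-1) / (q - q^-1))%:A : laurent A) (- (2 * i)))).
rewrite Useries_even scalar_coef /coef_c /affine_seq; congr (_ + _).
by rewrite oppr_eq0 mulf_eq0.
Qed.

Lemma Kmx_c0 i : Kuv o1 o0 (1 - 2 * i) = 0.
Proof.
rewrite mxE /= -[LHS]/((kp * (q + q^-1))^-1 *: (Gminus_series g (1 - 2 * i)) +
  (((km * (q + q^-1) / (q - q^-1))%:A : laurent A) (1 - 2 * i))).
rewrite Useries_odd scalar_coef scaler0 add0r.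
by case: eqP => // ?; lia.
Qed.

End GeneratingSeries.

(** * Both sets of relations read in the target of a morphism *)

Section RelationsUnderMorphism.
Variables (K : fieldType) (A B : algType {fraction {poly K}}).
Variables (phi : {lrmorphism A -> B}) (g : alt_gen -> A).
Variables kp km : {fraction {poly K}}.

Local Notation q := (qvar K).
Local Notation "i '# j" := (mxtens_index (i, j)) (at level 20).
Local Notation Wn := (fun k => phi (g (Wneg k))).
Local Notation Wp := (fun k => phi (g (Wpos k))).
Local Notation G := (fun k => phi (g (Gplus k))).
Local Notation Gt := (fun k => phi (g (Gtilde k))).
Local Notation kuv := (fun i j n => phi (Kmx g kp km i j n)).

Lemma FM_relations_exchange :
  (forall x y, FM_relations g kp km x y -> phi x = phi y) <->
  (forall i j k l : 'I_2, exchange q kuv i j k l).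
Proof.
split=> [FM i j k l n m|E _ _ [i j m n]].
  have := FM _ _ (FM_relation g kp km (i '# j) (k '# l) m n).
  rewrite FM_lhs_coef FM_rhs_coef exchange_left_morph exchange_right_morph.
  by [].
case: i / (mxtens_indexP i) => i i'; case: j / (mxtens_indexP j) => j j'.
rewrite FM_lhs_coef FM_rhs_coef exchange_left_morph exchange_right_morph.
exact: E.
Qed.

Lemma FM_relations_system : q != 0 ->
  (forall x y, FM_relations g kp km x y -> phi x = phi y) <->
  fm_system q (coef_a q Wn) (coef_b q kp km G) (coef_c q kp km Gt) (coef_d q Wp).
Proof.
move=> q0; apply: iff_trans FM_relations_exchange _.
have k0 x : x = 0 -> phi x = 0 by move=> ->; exact: raddf0.
apply: exchange_systemP => // i; rewrite /odd_exponent /even_exponent.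
- by rewrite Kmx_a; apply: affine_seq_morph.
- by rewrite Kmx_a0 k0.
- by rewrite Kmx_b; apply: affine_seq_morph.
- by rewrite Kmx_b0 k0.
- by rewrite Kmx_c; apply: affine_seq_morph.
- by rewrite Kmx_c0 k0.
- by rewrite Kmx_d; apply: affine_seq_morph.
- by rewrite Kmx_d0 k0.
Qed.

Let phiE :=
  (fun c x => linearZ_LR phi c x : phi (c *: x) = c *: phi x,
   fun x y => raddfD phi x y : phi (x + y) = phi x + phi y,
   fun x => raddfN phi x : phi (- x) = - phi x,
   fun x y => rmorphM phi x y : phi (x * y) = phi x * phi y,
   raddf0 phi : phi 0 = 0).

Let phi_comm x y : phi (comm x y) = commutator (phi x) (phi y).
Proof. by rewrite /comm !phiE. Qed.

Let phi_qcomm x y : phi (qcomm x y) = qcommutator q (phi x) (phi y).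
Proof. by rewrite /qcomm !phiE. Qed.

Lemma Aq_relations_alternating (rho : {fraction {poly K}}) :
  (forall x y, Aq_relations g rho x y -> phi x = phi y) <->
  alternating_relations q Wn Wp G Gt rho.
Proof.
split=> [rel|].
{ split=> [k|k|k|k|k|k|k l|k l|k l|k l|k l|k l|k l|k l|k l|k l].
    all: [> have := rel _ _ (Aq_W0Wp g rho k) | have := rel _ _ (Aq_WnW1 g rho
    k) | have := rel _ _ (Aq_W0G g rho k) | have := rel _ _ (Aq_GtW0 g rho k)
    | have := rel _ _ (Aq_GW1 g rho k) | have := rel _ _ (Aq_W1Gt g rho k) |
    have := rel _ _ (Aq_WnWn g rho k l) | have := rel _ _ (Aq_WpWp g rho k l)
    | have := rel _ _ (Aq_WnWp g rho k l) | have := rel _ _ (Aq_WnG g rho k l)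
    | have := rel _ _ (Aq_WnGt g rho k l) | have := rel _ _ (Aq_WpG g rho k l)
    | have := rel _ _ (Aq_WpGt g rho k l) | have := rel _ _ (Aq_GG g rho k l)
    | have := rel _ _ (Aq_GtGt g rho k l) | have := rel _ _ (Aq_GtG g rho k l)
    ].
  all: rewrite ?(phi_comm, phi_qcomm, phiE).
  all: by []. }
case=> W0Wp WnW1 W0G GtW0 GW1 W1Gt WnWn WpWp WnWp WnG WnGt WpG WpGt GG GtGt GtG x y.
case=> [k|k|k|k|k|k|k l|k l|k l|k l|k l|k l|k l|k l|k l|k l];
  rewrite ?(phi_comm, phi_qcomm, phiE).
all: [> exact (W0Wp k) | exact (WnW1 k) | exact (W0G k) | exact (GtW0 k)
  | exact (GW1 k) | exact (W1Gt k) | exact (WnWn k l) | exact (WpWp k l)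
  | exact (WnWp k l) | exact (WnG k l) | exact (WnGt k l) | exact (WpG k l)
  | exact (WpGt k l) | exact (GG k l) | exact (GtGt k l) | exact (GtG k l)].
Qed.

End RelationsUnderMorphism.

(** * Nonvanishing of q, q + q^-1 and q - q^-1 *)

Section QVariable.
Variable K : fieldType.

Local Notation q := (qvar K).

Lemma qvar_neq0 : q != 0.
Proof. by rewrite /qvar tofrac_eq0 polyX_eq0. Qed.

(** A monic quadratic polynomial is nonzero; c = 1 and c = -1 give q (q + q^-1) and q (q - q^-1). *)
Let qvar_sqr_neq (c : K) : q ^+ 2 + FracField.tofrac c%:P != 0.
Proof.
rewrite /qvar -tofracXn -tofracD tofrac_eq0.
rewrite -size_poly_gt0 size_polyDl ?size_polyXn// size_polyC.
by case: (c != 0).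
Qed.

Lemma qvarD_neq0 : q + q^-1 != 0.
Proof.
have := qvar_sqr_neq 1; rewrite tofrac1; apply: contraNneq => q1.
by rewrite expr2 -(mulfV qvar_neq0) -mulrDr q1 mulr0.
Qed.

Lemma qvarB_neq0 : q - q^-1 != 0.
Proof.
have := qvar_sqr_neq (-1); rewrite polyCN tofracN tofrac1; apply: contraNneq => q1.
by rewrite expr2 -(mulfV qvar_neq0) -mulrBr q1 mulr0.
Qed.

End QVariable.

(** * Comparison of ideals through morphisms *)

Section IdealComparison.
Variables (F : fieldType) (I : choiceType).
Implicit Types S T : free_alg F I -> free_alg F I -> Prop.

(** The hypothesis is applied to the projection onto the quotient by T: it respects T, hence S, so S
    lies in the ideal of T. *)
Lemma relation_ideal_incl S T :
    (forall (A : algType F) (phi : {lrmorphism free_alg F I -> A}),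
       (forall x y, T x y -> phi x = phi y) -> forall x y, S x y -> phi x = phi y) ->
  forall x, relation_ideal S x -> relation_ideal T x.
Proof.
move=> ST x Sx; have [T1|T1] := pselect (proper_relations T); last first.
  rewrite -[x]mulr1; apply: relation_idealMl.
  by have [//|T1'] := pselect (relation_ideal T 1); case: T1.
have TT u v : T u v -> presented_pi T1 u = presented_pi T1 v.
  by move=> Tuv; apply/presented_piP; exact: relation_ideal_rel.
elim: Sx => [u v Suv||u v _ Tu _ Tv|a u _ Tu|a u _ Tu].
- by apply/(presented_piP T1); apply: ST Suv => //; exact: TT.
- exact: relation_ideal0.
- exact: relation_idealD.
- exact: relation_idealMl.
- exact: relation_idealMr.
Qed.

End IdealComparison.

(** * The Freidel-Maillet presentation *)

Section FreidelMaillet.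
Variables (K : fieldType) (A B : algType {fraction {poly K}}).
Variables (phi : {lrmorphism A -> B}) (g : alt_gen -> A).
Variables kp km : {fraction {poly K}}.
Hypotheses (kp_neq0 : kp != 0) (km_neq0 : km != 0).

Local Notation q := (qvar K).

Lemma FM_Aq_relations :
  (forall x y, FM_relations g kp km x y -> phi x = phi y) <->
  (forall x y, Aq_relations g (kp * km * (q + q^-1) ^+ 2) x y -> phi x = phi y).
Proof.
have q0 := qvar_neq0 K; have e0 := qvarB_neq0 K; have s0 := qvarD_neq0 K.
exact (iff_trans (FM_relations_system phi g kp km q0)
  (iff_trans (fm_system_alternatingP _ _ _ _ q0 e0 s0 kp_neq0 km_neq0)
    (iff_sym (Aq_relations_alternating phi g _)))).
Qed.

End FreidelMaillet.

Theorem theorem3p1 (K : closedFieldType) (charK : [pchar K] =i pred0)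
    (kp km : {fraction {poly K}}) (kp_neq0 : kp != 0) (km_neq0 : km != 0) :
  presented_by (@Aq_gen K (kp * km * (qvar K + (qvar K)^-1) ^+ 2)) (FM_relations (@free_gen _ alt_gen) kp km).
Proof.
have [phi [phi_gen phi_onto phi_ker]] :=
  AqP (kp * km * (qvar K + (qvar K)^-1) ^+ 2).
(* The morphism of the alternating presentation serves again; only its kernel is described anew, by
   the equality of the two ideals. *)
exists phi; split=> // x; rewrite phi_ker; split; apply: relation_ideal_incl.
- by move=> A psi /(FM_Aq_relations psi _ kp_neq0 km_neq0).
- by move=> A psi /(FM_Aq_relations psi _ kp_neq0 km_neq0).
Qed.
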